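(* There exists a universal constant $\hat b>0$ such that the following holds for every finite group $G$ and every real $c>0$. For each integer $n\ge1$ let $Q$ be the one-step distribution of the paired shuffles random walk on $G\wr S_n$, let $U$ be the uniform probability measure on $G\wr S_n$, and let $Q_t$ be the distribution at time $t$ of the continuized chain corresponding to $Q$ (all defined in the context). Let $t_n=\tfrac12 n\log n+cn$. Then $$\limsup_{n\to\infty}\|Q_{t_n}-U\|_{\mathrm{TV}}\ \le\ \hat b\,e^{-c}.$$
   Context: The complete monomial group (wreath product) $G\wr S_n$ is the set $G^n\times S_n$, with elements written $(\vec x;\pi)$, $\vec x=(x_1,\dots,x_n)\in G^n$, $\pi\in S_n$, and multiplication $(\vec y;\sigma)(\vec x;\pi)=(y_1x_{\sigma^{-1}(1)},\dots,y_nx_{\sigma^{-1}(n)};\sigma\pi)$. It has $|G|^n n!$ elements and identity $(\vec e;e)$, where $\vec e=(e,\dots,e)$. The paired shuffles measure $Q$ on $G\wr S_n$ is the probability mass function: - $Q(\vec e;e)=\frac{1}{|G|n}$; - $Q(\vec u;e)=\frac{1}{|G|n^2}$ if $\vec u\in G^n$ has exactly one non-identity entry; - $Q(\vec v;\tau)=\frac{2}{|G|n^2}$ if $\tau=(p\ q)\in S_n$ is a transposition, all entries of $\vec v\in G^n$ outside positions $p$ and $q$ are the identity, and the entries in positions $p$ and $q$ are mutually inverse ($v_q=v_p^{-1}$); - $Q(\vec x;\pi)=0$ otherwise. The uniform measure is $U(\vec x;\pi)=\frac{1}{|G|^n n!}$. For functions $P,Q$ on a finite group $\Gamma$, $P*Q(g)=\sum_{h\in\Gamma}P(gh^{-1})Q(h)$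 and $Q^{*k}$ is the $k$-fold convolution power ($Q^{*0}$ is the point mass at the identity). The continuized chain corresponding to a probability measure $Q$ on $\Gamma$ is the continuous-time Markov chain on $\Gamma$ started at the identity with transition rates $q(g,h)=Q(hg^{-1})$ for $g\ne h$; its distribution at time $t\ge0$ is $Q_t(g)=\sum_{k=0}^\infty e^{-t}\frac{t^k}{k!}Q^{*k}(g)$. Total variation distance is $\|P-Q\|_{\mathrm{TV}}=\max_{A\subseteq \Gamma}|P(A)-Q(A)|$. Here $\log$ is the natural logarithm. *)

(* Defs.v *)
From HB Require Import structures.
From mathcomp Require Import all_boot all_order all_algebra all_fingroup.
From mathcomp Require Import all_classical all_reals all_analysis.

Set Implicit Arguments.
Unset Strict Implicit.
Unset Printing Implicit Defensive.

Import Order.TTheory GRing.Theory Num.Theory.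
Import numFieldNormedType.Exports.

Local Open Scope ring_scope.

(* The complete monomial group G wr S_n. A dedicated record is used because   *)
(* the product type already carries the direct product group structure.       *)
Record wreath (gT : finGroupType) (n : nat) := Wreath {
  wvec : {ffun 'I_n -> gT};
  wperm : {perm 'I_n}
}.

Section WreathGroup.
Variables (gT : finGroupType) (n : nat).
Implicit Types a b : wreath gT n.

Definition pair_of_wreath a := (wvec a, wperm a).
Definition wreath_of_pair (u : {ffun 'I_n -> gT} * {perm 'I_n}) :=
  Wreath u.1 u.2.

Lemma pair_of_wreathK : cancel pair_of_wreath wreath_of_pair.
Proof. by case. Qed.

HB.instance Definition _ := Finite.copy (wreath gT n) (can_type pair_of_wreathK).

(* (y; s) (x; p) = (i |-> y_i x_{s^-1 i}; s \o p). As the product of          *)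
(* permutations satisfies (p * s) i = s (p i), the composite s \o p is p * s. *)
Definition wreath_mul b a : wreath gT n :=
  Wreath [ffun i => (wvec b i * wvec a ((wperm b)^-1 i))%g]
         (wperm a * wperm b)%g.

Definition wreath_one : wreath gT n := Wreath [ffun=> 1%g] 1%g.

Definition wreath_inv a : wreath gT n :=
  Wreath [ffun i => (wvec a (wperm a i))^-1%g] (wperm a)^-1%g.

Lemma wreath_mulA : associative wreath_mul.
Proof.
move=> [x p] [y s] [z r]; congr Wreath; last by rewrite /= mulgA.
by apply/ffunP => i; rewrite !ffunE /= invMg permM mulgA.
Qed.

Lemma wreath_mul1 : left_id wreath_one wreath_mul.
Proof.
move=> [x p]; congr Wreath; last by rewrite /= mulg1.
by apply/ffunP => i; rewrite !ffunE /= invg1 perm1 mul1g.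
Qed.

Lemma wreath_mulV : left_inverse wreath_one wreath_inv wreath_mul.
Proof.
move=> [x p]; congr Wreath; last by rewrite /= mulgV.
by apply/ffunP => i; rewrite !ffunE /= invgK mulVg.
Qed.

HB.instance Definition _ :=
  Finite_isGroup.Build (wreath gT n) wreath_mulA wreath_mul1 wreath_mulV.

End WreathGroup.

Section PairedShuffles.
Variables (R : realType) (gT : finGroupType) (n : nat).

Definition one_nonid (x : {ffun 'I_n -> gT}) : bool :=
  #|[set i | x i != 1%g]| == 1%N.

Definition paired_transposition (x : {ffun 'I_n -> gT}) (s : {perm 'I_n}) :
    bool :=
  [exists p : 'I_n, exists q : 'I_n,
    [&& p != q, s == tperm p q, x q == (x p)^-1%g &
        [forall i, (i != p) ==> (i != q) ==> (x i == 1%g)]]].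

(* For n = 0 all the denominators vanish and this is the zero function.       *)
Definition paired_shuffles (g : wreath gT n) : R :=
  let x := wvec g in
  let s := wperm g in
  if s == 1%g then
    if x == [ffun=> 1%g] then 1 / (#|gT|%:R * n%:R)
    else if one_nonid x then 1 / (#|gT|%:R * n%:R ^+ 2)
    else 0
  else if paired_transposition x s then 2 / (#|gT|%:R * n%:R ^+ 2)
  else 0.

Definition wreath_uniform (g : wreath gT n) : R :=
  1 / (#|gT|%:R ^+ n * n`!%:R).

End PairedShuffles.

Section FiniteGroupMeasures.
Variables (R : realType) (T : finGroupType).
Implicit Types (P Q : T -> R).

Definition convolution P Q (g : T) : R := \sum_(h : T) P (g * h^-1)%g * Q h.

Definition convolution_pow Q (k : nat) : T -> R :=
  iter k (convolution Q) (fun g => (g == 1%g)%:R).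

Definition continuized Q (t : R) (g : T) : R :=
  limn (series (fun k =>
    expR (- t) * (t ^+ k / k`!%:R) * convolution_pow Q k g) : R^nat).

(* The event set0 contributes 0, so taking 0 as the neutral element of the    *)
(* maximum is harmless.                                                       *)
Definition tv_dist P Q : R :=
  \big[Num.max/0]_(A : {set T}) `|\sum_(g in A) P g - \sum_(g in A) Q g|.

End FiniteGroupMeasures.

(* Main.v *)
(* Only the shuffled permutation and the labels have to be controlled, and     *)
(* they decouple.  Conjugating by a label vector permutes the elements that    *)
(* make up each edge (p q) of the walk, so averaging over the labels at a      *)
(* single position p commutes with every step; an occurrence of the edge (p q) *)
(* makes the averages at p and q agree, and a loop at p makes the average at p *)
(* act trivially.  Hence the labels are exactly uniform, and independent of    *)
(* the permutation, as soon as the edges used contain a loop and cut no set of *)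
(* positions off.  A union bound over sets of at most n/2 positions shows that *)
(* this fails with probability O(e^-c) at time (n log n)/2 + c n.              *)
(*                                                                             *)
(* The permutation is a random transposition walk, bounded in l2 as by         *)
(* Diaconis and Shahshahani, but without characters.  Let K be the sum of the  *)
(* n^2 transpositions (x y), acting on functions on S_n.  In any space of      *)
(* functions stable under exchanges of positions take a nonzero function       *)
(* invariant under the exchanges within a set A of maximal size r, then repeat *)
(* the choice outside of A: the outcome is an eigenvector of K of eigenvalue   *)
(* at most min(n r, r^2 + (n - r)^2).  This shows that K is diagonalizable     *)
(* and, since a function invariant under the exchanges within r positions and  *)
(* with vanishing sums over the cosets given by the values at the n - r other  *)
(* positions is zero, that at most C(n, n - r) n^(n - r) eigenvalues exceed    *)
(* the bounds attained for smaller r.                                          *)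
From HB Require Import structures.
Require Import Defs.
From mathcomp Require Import all_boot all_order all_algebra all_fingroup.
From mathcomp Require Import all_classical all_reals all_analysis.
From mathcomp Require Import zify ring lra fintype finset.

Set Implicit Arguments.
Unset Strict Implicit.
Unset Printing Implicit Defensive.

Import Order.TTheory GRing.Theory Num.Theory.
Import numFieldNormedType.Exports.

Local Open Scope ring_scope.

(** * Functions on the symmetric group *)

(** By [paired_shufflesE] one step draws an ordered pair (p, q), loops included, and a group
    element, all uniformly. So the k-th convolution power averages [word_measure] over the n^(2k)
    words of edges ([convolution_pow_words]). The l1 distance to uniform splits into two parts.

    Labels: [good_word_label] and [labels_fixed] make them exactly uniform for a good word, so the
    distance from the law to its permutation marginal with uniform labels is at most twice the
    probability of a bad word ([shuffle_pow_dist]). Poisson averaging turns each x^k there into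
    exp(-t (1 - x)), and [cut_term_le] bounds the sum over sets by a geometric series in 4 exp(-c).

    Permutation: Cauchy-Schwarz and [sum_perm_continuized_sqr] reduce the distance to the sum of
    exp(-2 t (1 - d / n^2)) over the eigenvalues d of K, minus 1. [swap_mx_spectrum] counts these in
    layers, and [shape_term_le] bounds the layers by a geometric series in 16 exp(-2 c).

    All bounds hold for each positive n, and together they give 24 exp(-c). *)

Section Transpositions.
Variables (R : realType) (n : nat).
Notation T := {perm 'I_n}.
Notation V := {ffun T -> R}.
Implicit Types (f g h : V) (A B D : {set 'I_n}) (x y z : 'I_n).

Definition swap x y f : V := [ffun s => f (tperm x y * s)%g].

Lemma swapE x y f s : swap x y f s = f (tperm x y * s)%g.
Proof. by rewrite ffunE. Qed.

Lemma swap_is_linear x y : linear (swap x y).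
Proof. by move=> a f g; apply/ffunP => s; rewrite !ffunE. Qed.

HB.instance Definition _ x y :=
  GRing.isLinear.Build R V V *:%R (swap x y) (swap_is_linear x y).

Lemma swapC x y f : swap x y f = swap y x f.
Proof. by apply/ffunP => s; rewrite !ffunE tpermC. Qed.

Lemma swapxx x f : swap x x f = f.
Proof. by apply/ffunP => s; rewrite !ffunE tperm1 mul1g. Qed.

Lemma swapK x y : involutive (swap x y).
Proof. by move=> f; apply/ffunP => s; rewrite !ffunE mulgA tperm2 mul1g. Qed.

Lemma swap_conj x y u v f :
  swap x y (swap u v f) = swap (tperm x y u) (tperm x y v) (swap x y f).
Proof.
apply/ffunP => s; rewrite !ffunE !mulgA; congr (f (_ * s)%g).
by rewrite -(tpermJ u v (tperm x y)) conjgE tpermV !mulgA tperm2 mul1g.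
Qed.

Definition swap_sum D f : V := \sum_(x in D) \sum_(y in D) swap x y f.

Definition swap_closed D (S : V -> Prop) :=
  (forall a f g, S f -> S g -> S (a *: f + g)) /\
  (forall x y f, x \in D -> y \in D -> S f -> S (swap x y f)).

Definition swap_inv A f :=
  forall x y, x \in A -> y \in A -> swap x y f = f.

Lemma swap_inv1 x f : swap_inv [set x] f.
Proof. by move=> u v /set1P-> /set1P->; rewrite swapxx. Qed.

Lemma swap_inv0 f : swap_inv finset.set0 f.
Proof. by move=> u v; rewrite inE. Qed.

(** The identity and the exchanges of [x] with [A] represent the cosets of the symmetric group of
    [A] in that of [x |: A], so this is, up to a positive factor, the sum of all translates of [f]
    under the larger group. *)
Lemma swap_invU1 A x f : x \notin A -> swap_inv A f ->
  swap_inv (x |: A) (f + \sum_(a in A) swap x a f).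
Proof.
move=> xA fA.
have neqA a : a \in A -> x != a by move=> aA; apply: contraNneq xA => ->.
have swx b : b \in A -> swap x b (f + \sum_(a in A) swap x a f) =
    f + \sum_(a in A) swap x a f.
  move=> bA; rewrite linearD linear_sum (bigD1 b bA) [in RHS](bigD1 b bA) /=.
  rewrite swapK addrCA; congr (_ + (_ + _)); apply: eq_bigr => a /andP[aA ab].
  by rewrite -[in RHS](fA a b) // [RHS]swap_conj tpermR tpermD // ?neqA // eq_sym neqA.
move=> u v /setU1P[->|uA] /setU1P[->|vA].
- by rewrite swapxx.
- exact: swx.
- by rewrite swapC; exact: swx.
- have [->|uv] := eqVneq u v; first by rewrite swapxx.
  rewrite linearD linear_sum /= fA //; congr (_ + _).
  rewrite (reindex_inj (@perm_inj _ (tperm u v))) /=.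
  apply: eq_big => [a|a aA].
    by case: tpermP => [->|->|//]; rewrite ?uA ?vA.
  by rewrite swap_conj tpermK fA // tpermD // eq_sym neqA.
Qed.

(** Pairs inside [A] fix [f]. By the hypothesis each [x] outside of [A] contributes [- f] through
    its exchanges with [A], and these crossing pairs occur in both orders. *)
Lemma swap_sum_split A D f : A \subset D -> swap_inv A f ->
  (forall x, x \in D :\: A -> f + \sum_(a in A) swap x a f = 0) ->
  swap_sum D f =
    ((#|A| ^ 2)%:R - (2 * #|D :\: A|)%:R) *: f + swap_sum (D :\: A) f.
Proof.
move=> AD fA fD.
have splitD (F : 'I_n -> V) : \sum_(x in D) F x =
    \sum_(x in A) F x + \sum_(x in D :\: A) F x.
  by rewrite (big_setID A) /= (finset.setIidPr AD).
have crossE x : x \in D :\: A -> \sum_(a in A) swap x a f = - f.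
  by move=> /fD /eqP; rewrite addrC addr_eq0 => /eqP.
rewrite /swap_sum splitD.
under eq_bigr do rewrite splitD.
under [X in _ + X]eq_bigr do rewrite splitD.
rewrite !big_split /= addrA; congr (_ + _).
rewrite [X in _ + X + _]exchange_big /=.
rewrite [X in _ + X + _](eq_bigr (fun=> - f)) => [|x xD]; last first.
  by under eq_bigr do rewrite swapC; exact: crossE.
rewrite [X in _ + _ + X](eq_bigr (fun=> - f)); last by [].
rewrite (eq_bigr (fun=> #|A|%:R *: f)); last first.
  move=> x xA; rewrite (eq_bigr (fun=> f)) => [|y yA]; last exact: fA.
  by rewrite sumr_const scaler_nat.
rewrite !sumr_const !mulNrn -![f *+ _]scaler_nat -[_ *: f *+ _]scaler_nat scalerA -!scalerBl.
by congr (_ *: _); rewrite natrX natrM; ring.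
Qed.

Lemma swap_closed_sum D S (I : Type) (r : seq I) (P : pred I) (F : I -> V) :
  swap_closed D S -> S 0 -> (forall i, P i -> S (F i)) -> S (\sum_(i <- r | P i) F i).
Proof.
move=> [SD _] S0 SF; elim/big_rec: _ => // i g /SF SFi Sg.
by rewrite -[F i]scale1r; exact: SD.
Qed.

(* Choose [A] maximal with a nonzero [A]-invariant element [f] in [S]: then   *)
(* [f] plus its exchanges of [x] with [A] is invariant under [x |: A], hence  *)
(* vanishes, and [swap_sum D] acts on [f] by a scalar up to the transpositions *)
(* outside of [A].                                                            *)
Lemma swap_sum_eigenvector D S f :
  swap_closed D S -> S f -> f != 0 ->
  exists g A m, [/\ [/\ S g, g != 0, A \subset D & swap_inv A g],
    swap_sum D g = (m%:R - (#|D| ^ 2)%:R) *: g,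
    (m <= #|D| ^ 2 + #|D| * #|A|)%N,
    (m <= #|D| ^ 2 + #|A| ^ 2 + (#|D| - #|A|) ^ 2)%N &
    (0 < #|D| -> 0 < #|A|)%N].
Proof.
have [d] := ubnP #|D|; elim: d => // d IHd in D S f *.
rewrite ltnS => leDd SD Sf f0.
have [/eqP|D0] := posnP #|D|.
  rewrite cards_eq0 => /eqP D0; exists f, finset.set0, 0%N; split=> //.
  - by split=> //; [exact: finset.sub0set|exact: swap_inv0].
  - by rewrite D0 /swap_sum big_set0 cards0 exp0n // subrr scale0r.
have [x xD] : exists x, x \in D by apply/card_gt0P.
pose P := [pred A : {set 'I_n} | (A \subset D) &&
  `[< exists g, [/\ S g, g != 0 & swap_inv A g] >]].
have P1 : P [set x]%SET.
  rewrite /= finset.sub1set xD; apply/asboolP; exists f.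
  by split=> //; exact: swap_inv1.
case: (arg_maxnP (fun A : {set 'I_n} => #|A|) P1) => A /= /andP[AD /asboolP[g [Sg g0 gA]]] maxA.
have A0 : (0 < #|A|)%N by rewrite -(cards1 x) maxA.
have maxS B h : B \subset D -> S h -> h != 0 -> swap_inv B h -> (#|B| <= #|A|)%N.
  by move=> BD Sh h0 hB; apply: maxA; rewrite BD; apply/asboolP; exists h.
have S0 : S 0 by rewrite -(addNr g) -scaleN1r; apply: SD.1.
have cardDA : #|D :\: A| = (#|D| - #|A|)%N by rewrite cardsD (finset.setIidPr AD).
have leAD : (#|A| <= #|D|)%N by exact: subset_leq_card.
(* The recursion keeps [A]-invariance, which exchanges outside of [A] preserve because they commute
   with those inside. *)
pose S' h := S h /\ swap_inv A h.
have S'D : swap_closed (D :\: A) S'.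
  split=> [a h1 h2 [Sh1 h1A] [Sh2 h2A]|u v h uD vD [Sh hA]]; split.
  - exact: SD.1.
  - by move=> u v uA vA; rewrite linearP /= h1A ?h2A.
  - by apply: SD.2 => //; [move: uD|move: vD]; rewrite inE => /andP[].
  - move=> y z yA zA; rewrite swap_conj.
    have fixed w t : w \in A -> t \in D :\: A -> w != t.
      by move=> wA; apply: contraTneq => <-; rewrite inE wA.
    by rewrite tpermD ?fixed 1?tpermD ?fixed 1?hA.
have ltDA : (#|D :\: A| < d)%N by rewrite cardDA; lia.
have [h [B [m [[[Sh hA] h0 BD hB] hE mB _ _]]]] := IHd _ _ g ltDA S'D (conj Sg gA) g0.
(* With k the size of [D :\: A], this is [#|A| ^ 2] - 2 k + (m - k^2) shifted by [#|D| ^ 2]. The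
   first bound comes from [#|B| <= #|A|] (maximality of [A]), the second from [#|B|] being at most
   k. *)
exists h, A, (2 * #|D| * (#|A| - 1) + 2 * #|A| + m)%N.
have BleA : (#|B| <= #|A|)%N.
  by apply: (maxS B h) => //; exact: (fintype.subset_trans BD (finset.subsetDl D A)).
have BleD := subset_leq_card BD.
rewrite cardDA in mB BleD.
have [k Dk] : exists k, #|D| = (#|A| + k)%N.
  by exists (#|D| - #|A|)%N; rewrite subnKC.
have kE : (#|D| - #|A| = k)%N by rewrite Dk addKn.
rewrite kE -!mulnn in mB BleD.
have kBA := leq_mul (leqnn k) BleA.
have kBD := leq_mul (leqnn k) BleD.
split=> //; last first.
- rewrite kE Dk -!mulnn; case: #|A| A0 kBA => // a _ kBA; rewrite subSS subn0.
  by lia.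
- rewrite Dk -!mulnn; case: #|A| A0 kBA => // a _ kBA; rewrite subSS subn0.
  by lia.
- rewrite (swap_sum_split AD) ?hE => [||y].
  + rewrite -scalerDl cardDA; congr (_ *: _).
    rewrite kE Dk -!mulnn; case: #|A| A0 => // a _.
    by rewrite subSS subn0 -addn1 !(natrD, natrM); ring.
  + by [].
  + rewrite inE => /andP[yA yD].
    apply/eqP; apply: contraT => k0.
    have := maxS (y |: A)%SET _ _ _ k0 (swap_invU1 yA hA).
    rewrite cardsU1 yA /= add1n ltnn => ->//.
      by rewrite finset.subUset finset.sub1set yD.
    rewrite -[X in S (X + _)]scale1r; apply: SD.1 => //.
    apply: (swap_closed_sum _ SD) => // a aA; apply: SD.2 => //.
    by move/subsetP: AD; apply.
Qed.

End Transpositions.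

(** * Diagonalizing real symmetric matrices and counting eigenvalues *)

Section SymmetricMatrices.
Variables (R : realType) (m : nat).
Implicit Types (K P : 'M[R]_m.+1) (u v : 'rV[R]_m.+1) (p q : {poly R}).

Lemma mulmx_horner_eigen K v a q :
  v *m K = a *: v -> v *m horner_mx K q = q.[a] *: v.
Proof.
move=> vK; elim/poly_ind: q => [|q b IHq].
  by rewrite rmorph0 mulmx0 horner0 scale0r.
rewrite rmorphD rmorphM /= horner_mx_X horner_mx_C mulmxDr mulmxA IHq.
by rewrite -scalemxAl vK scalerA mul_mx_scalar -scalerDl hornerMXaddC.
Qed.

Lemma row_mul_tr_eq0 u : (u *m u^T == 0) = (u == 0).
Proof.
apply/eqP/eqP => [/matrixP/(_ 0 0)|->]; last by rewrite mul0mx.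
rewrite !mxE => /eqP; rewrite psumr_eq0 => [/allP u0|i _]; last first.
  by rewrite mxE -expr2 sqr_ge0.
apply/rowP => i; have := u0 i; rewrite mem_index_enum mxE mulf_eq0 orbb.
by move=> /(_ isT)/eqP ->; rewrite mxE.
Qed.

(* The product of the [K - a] over [a] in [rs] vanishes: otherwise its image   *)
(* contains an eigenvector [w (K - a)] of eigenvalue [a], so [w (K - a)^2 = 0] *)
(* and [w (K - a) = 0] by symmetry of [K].                                     *)
Lemma symmetric_diagonalizable K (rs : seq R) : uniq rs -> K^T = K ->
  (forall p, horner_mx K p != 0 -> exists v a,
     [/\ a \in rs, v *m horner_mx K p != 0 &
         (v *m horner_mx K p) *m K = a *: (v *m horner_mx K p)]) ->
  exists P (d : 'rV[R]_m.+1), P \in unitmx /\ P *m K = diag_mx d *m P.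
Proof.
move=> rsU Ksym Kp.
have: horner_mx K (\prod_(a <- rs) ('X - a%:P)) = 0.
  apply/eqP; apply: contraT => /Kp[v [a [ars u0 uK]]].
  rewrite (bigD1_seq a) //= mulrC in u0 uK.
  set q := \prod_(i <- rs | _) _ in u0 uK.
  rewrite rmorphM rmorphB /= horner_mx_X horner_mx_C mulmxA in u0 uK.
  set w := v *m horner_mx K q in u0 uK.
  have KaT : (K - a%:M)^T = K - a%:M by rewrite linearB /= Ksym tr_scalar_mx.
  case/negP: u0; rewrite -row_mul_tr_eq0 trmx_mul KaT mulmxA.
  by rewrite mulmxBr uK mul_mx_scalar subrr mul0mx.
move/mxminpoly_min => minK.
have [P Pu /diagonalizable_forPex[d /(simmxP Pu) PK]] : diagonalizable K.
  by apply/diagonalizableP; exists rs.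
by exists P, d.
Qed.

(* If there were more than [M] eigenvalues above [b], a nonzero combination   *)
(* of their eigenvectors would satisfy the [M] linear constraints [C].        *)
Lemma card_eigenvalues_gt K P (d : 'rV[R]_m.+1) M (C : 'M[R]_(m.+1, M)) (b : R) :
  P \in unitmx -> P *m K = diag_mx d *m P ->
  (forall q (v : 'rV_m.+1), v != 0 -> v *m C = 0 -> v *m horner_mx K q = 0 ->
     exists (w : 'rV_m.+1) a, [/\ w != 0, w *m horner_mx K q = 0, w *m K = a *: w & a <= b]) ->
  (#|[set i | (b < d 0 i)%R]| <= M)%N.
Proof.
move=> Pu PK KC; set B := [set i | _]; rewrite leqNgt; apply/negP => ltMB.
pose PB := rowsub (enum_val : 'I_#|B| -> _) P.
have PBfree : row_free PB.
  apply/row_freeP; exists (invmx P *m (rowsub (enum_val : 'I_#|B| -> _) 1%:M)^T).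
  rewrite mulmxA /PB !mul_rowsub_mx mulmxV // mul1mx.
  by apply/matrixP => i j; rewrite !mxE (inj_eq enum_val_inj) eq_sym.
have [u u0 uC] : exists2 u : 'rV_#|B|, u != 0 & u *m (PB *m C) = 0.
  have kerN0 : kermx (PB *m C) != 0.
    rewrite kermx_eq0 /row_free neq_ltn.
    by rewrite (leq_ltn_trans (rank_leq_col _)).
  exists (nz_row (kermx (PB *m C))); first by rewrite nz_row_eq0.
  by apply/sub_kermxP; exact: nz_row_sub.
(* [q] annihilates the span of the chosen eigenvectors, and an eigenvector killed by [q] has one of
   the values [d 0 i > b] as eigenvalue, which contradicts [a <= b]. *)
pose q := \prod_(i in B) ('X - (d 0 i)%:P).
have rowPK i : row i P *m K = d 0 i *: row i P.
  by rewrite -row_mul PK row_mul row_diag_mx -scalemxAl -rowE.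
have PBq : PB *m horner_mx K q = 0.
  apply/row_matrixP => i; rewrite row_mul row0 row_rowsub.
  rewrite (mulmx_horner_eigen _ (rowPK _)) /q horner_prod.
  rewrite (bigD1 (enum_val i)) ?enum_valP //=.
  by rewrite !hornerE subrr mul0r scale0r.
have [| | |w [a [w0 wq wK leab]]] := KC q (u *m PB).
- by rewrite mulmx_free_eq0.
- by rewrite -mulmxA.
- by rewrite -mulmxA PBq mulmx0.
move/eqP: wq; rewrite (mulmx_horner_eigen _ wK) scaler_eq0 (negbTE w0) orbF.
rewrite horner_prod => /prodf_eq0[i /[!inE] bi].
rewrite !hornerE subr_eq0 => /eqP da.
by move: leab; rewrite da leNgt bi.
Qed.

End SymmetricMatrices.

(** * The spectrum of the sum of the transpositions *)

Section SwapMatrix.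
Variables (R : realType) (n : nat).
Notation T := {perm 'I_n}.
Notation V := {ffun T -> R}.
Implicit Types (f g h : V) (A B D I : {set 'I_n}) (x y z : 'I_n) (s t : T).

(** Transpositions inside [A] bring the values of [s] to the places they have in [t], one position
    at a time. *)
Lemma swap_inv_agree A f s t :
  swap_inv A f -> (forall i, i \notin A -> s i = t i) -> f s = f t.
Proof.
move=> fA; have [d] := ubnP #|[set i | s i != t i]|.
elim: d => // d IHd in s *; rewrite ltnS => led st.
have [/eqP|] := posnP #|[set i | s i != t i]|.
  rewrite cards_eq0 => /eqP s0; congr (f _); apply/permP => i.
  by apply/eqP; move/setP/(_ i): s0; rewrite !inE => /negbFE.
case/card_gt0P => i; rewrite inE => sti.
have iA : i \in A by apply: contraNT sti => /st ->.
have [k sk] : exists k, s k = t i by exists ((s^-1)%g (t i)); rewrite permKV.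
have kA : k \in A.
  by apply: contraT => kA; move: (st _ kA); rewrite sk => /perm_inj ik; rewrite -ik iA in kA.
have ki : k != i by apply: contraNneq sti => ki; rewrite -{1}ki sk.
rewrite -[in LHS](fA i k) // swapE; apply: IHd => [|j jA]; last first.
  rewrite permM tpermD ?st //; first by apply: contraNneq jA => <-.
  by apply: contraNneq jA => <-.
apply: leq_trans led; apply: proper_card; apply/properP; split.
  apply/subsetP => j; rewrite !inE permM; case: tpermP => [->|->|//].
    by rewrite sk eqxx.
  by rewrite sk => _; apply: contraNneq ki => /perm_inj ->.
by exists i; rewrite !inE // permM tpermL sk eqxx.
Qed.

Definition cylinder_sum I s f : R :=
  \sum_(t : T | [forall i in I, t i == s i]) f t.

Definition cylinder_null j f := forall I s, #|I| = j -> cylinder_sum I s f = 0.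

Lemma cylinder_null_swap j x y f :
  cylinder_null j f -> cylinder_null j (swap x y f).
Proof.
move=> fj I s Ij; rewrite /cylinder_sum (reindex_inj (mulgI (tperm x y))) /=.
apply: etrans (fj [set tperm x y i | i in I] (tperm x y * s)%g _); last first.
  by rewrite card_imset //; exact: perm_inj.
rewrite /cylinder_sum; apply: eq_big => [t|t _]; last first.
  by rewrite swapE mulgA tperm2 mul1g.
apply/forall_inP/forall_inP => [ts _ /imsetP[i iI ->]|ts i iI].
  by have := ts i iI; rewrite !permM tpermK.
by have := ts (tperm x y i) (imset_f _ iI); rewrite !permM tpermK.
Qed.

Lemma cylinder_nullD j a f g :
  cylinder_null j f -> cylinder_null j g -> cylinder_null j (a *: f + g).
Proof.
move=> fj gj I s Ij; rewrite /cylinder_sum.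
under eq_bigr do rewrite !ffunE.
by rewrite big_split -mulr_sumr /= [X in _ * X]fj // [X in _ + X]gj // mulr0 addr0.
Qed.

(** On a coset fixing the values off an [r]-subset of [A], [f] is constant, so its vanishing sum
    there is a positive multiple of each value. *)
Lemma cylinder_null_swap_inv r A f :
  cylinder_null (n - r) f -> swap_inv A f -> (r <= #|A|)%N -> f = 0.
Proof.
move=> fr fA /card_geqP[B [Bu Br BA]].
pose B' := [set x in B]; have B'r : #|B'| = r.
  by rewrite cardsE (card_uniqP Bu).
apply/ffunP => s; rewrite ffunE.
have := fr (~: B') s; rewrite cardsCs finset.setCK card_ord B'r => /(_ erefl).
rewrite /cylinder_sum (eq_bigr (fun=> f s)) => [|t /forall_inP ts]; last first.
  apply: (@swap_inv_agree B') => [x y|i iB].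
    by rewrite !inE => xB yB; apply: fA; apply: BA.
  by apply/eqP/ts; rewrite inE.
rewrite sumr_const => /eqP; rewrite mulrn_eq0 => /orP[|/eqP//].
rewrite -leqn0 leqNgt => /negP[]; apply/card_gt0P; exists s.
exact/forall_inP.
Qed.

(** Conjugation by [s] permutes the pairs (x, y), so transposing positions or values gives the same
    sum. The second form visibly commutes with left translations. *)
Lemma swap_sumTE f s :
  swap_sum setT f s = \sum_x \sum_y f (s * tperm x y)%g.
Proof.
rewrite /swap_sum sum_ffunE (eq_bigl xpredT) => [|x]; last by rewrite inE.
rewrite [in RHS](reindex_inj (@perm_inj _ s)).
apply: eq_bigr => x _.
rewrite sum_ffunE (eq_bigl xpredT) => [|y]; last by rewrite inE.
rewrite [in RHS](reindex_inj (@perm_inj _ s)); apply: eq_bigr => y _.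
rewrite swapE -(tpermJ x y s) conjgE; congr (f _).
by rewrite !mulgA mulgV mul1g.
Qed.

Definition lshift_ffun s f : V := [ffun t => f (s * t)%g].

Lemma swap_sumT_lshift s f :
  swap_sum setT (lshift_ffun s f) = lshift_ffun s (swap_sum setT f).
Proof.
apply/ffunP => t; rewrite ffunE !swap_sumTE.
by do 2 (apply: eq_bigr => ? _); rewrite ffunE mulgA.
Qed.

(** The predecessor is taken because [horner_mx] needs a matrix size of the form [m.+1]. *)
Definition nperms := #|T|.-1.

Lemma card_perms : nperms.+1 = #|T|.
Proof. by rewrite prednK //; apply/card_gt0P; exists 1%g. Qed.

Definition perm_of (i : 'I_nperms.+1) : T := enum_val (cast_ord card_perms i).
Definition perm_rank s : 'I_nperms.+1 := cast_ord (esym card_perms) (enum_rank s).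

Lemma perm_rankK : cancel perm_rank perm_of.
Proof. by move=> s; rewrite /perm_of cast_ordKV enum_rankK. Qed.

Lemma perm_ofK : cancel perm_of perm_rank.
Proof. by move=> i; rewrite /perm_rank enum_valK cast_ordK. Qed.

Lemma sum_perm_of (U : nmodType) (F : T -> U) : \sum_i F (perm_of i) = \sum_s F s.
Proof.
rewrite [RHS](reindex perm_of) //.
exact: onW_bij (Bijective perm_ofK perm_rankK).
Qed.

Definition rowf f : 'rV[R]_nperms.+1 := \row_i f (perm_of i).
Definition unrowf (v : 'rV[R]_nperms.+1) : V := [ffun s => v 0 (perm_rank s)].

Lemma unrowfK : cancel unrowf rowf.
Proof. by move=> v; apply/rowP => i; rewrite mxE ffunE perm_ofK. Qed.

Lemma rowfK : cancel rowf unrowf.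
Proof. by move=> f; apply/ffunP => s; rewrite ffunE mxE perm_rankK. Qed.

Lemma rowf_is_linear : linear rowf.
Proof. by move=> a f g; apply/rowP => i; rewrite !mxE !ffunE. Qed.

HB.instance Definition _ :=
  GRing.isLinear.Build R V 'rV[R]_nperms.+1 *:%R rowf rowf_is_linear.

Lemma rowf_eq0 f : (rowf f == 0) = (f == 0).
Proof.
apply/eqP/eqP => [/rowP f0|->]; last by rewrite linear0.
by apply/ffunP => s; have := f0 (perm_rank s); rewrite !mxE ffunE perm_rankK.
Qed.

Definition swap_mx : 'M[R]_nperms.+1 :=
  \matrix_(i, j) \sum_x \sum_y (perm_of i == perm_of j * tperm x y)%g%:R.

Lemma rowf_swap_mx f : rowf f *m swap_mx = rowf (swap_sum setT f).
Proof.
apply/rowP => j; rewrite !mxE swap_sumTE.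
under eq_bigr do rewrite !mxE mulr_sumr.
rewrite exchange_big; apply: eq_bigr => x _ /=.
under eq_bigr do rewrite mulr_sumr.
rewrite exchange_big; apply: eq_bigr => y _ /=.
rewrite (sum_perm_of (fun s => f s * (s == perm_of j * tperm x y)%g%:R)).
rewrite (bigD1 (perm_of j * tperm x y)%g) //= eqxx mulr1 big1 ?addr0 // => s.
by move=> /negbTE->; rewrite mulr0.
Qed.

Lemma tr_swap_mx : swap_mx^T = swap_mx.
Proof.
apply/matrixP => i j; rewrite !mxE; apply: eq_bigr => x _; apply: eq_bigr => y _.
congr ((_ : bool)%:R); apply/eqP/eqP => ->; by rewrite -mulgA tperm2 mulg1.
Qed.

Definition swap_horner q f : V := unrowf (rowf f *m horner_mx swap_mx q).

(** As [swap x y] is itself a left translation, images and kernels of polynomials in K are stable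
    under exchanges, as [swap_mx_eigenvector] requires. *)
Lemma swap_horner_lshift q s f :
  swap_horner q (lshift_ffun s f) = lshift_ffun s (swap_horner q f).
Proof.
pose L : 'M[R]_nperms.+1 := \matrix_(i, j) (perm_of i == s * perm_of j)%g%:R.
have LE g : rowf g *m L = rowf (lshift_ffun s g).
  apply/rowP => j; rewrite !mxE ffunE.
  under eq_bigr do rewrite !mxE.
  rewrite (sum_perm_of (fun t => g t * (t == s * perm_of j)%g%:R)).
  rewrite (bigD1 (s * perm_of j)%g) //= eqxx mulr1 big1 ?addr0 // => t.
  by move=> /negbTE->; rewrite mulr0.
have LK : comm_mx L swap_mx.
  apply/row_matrixP => i; rewrite !rowE -[delta_mx 0 i]unrowfK !mulmxA.
  by rewrite rowf_swap_mx !LE rowf_swap_mx swap_sumT_lshift.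
apply: (can_inj rowfK); rewrite -LE !unrowfK -LE -!mulmxA.
by rewrite (comm_mx_horner _ LK).
Qed.

Lemma swap_horner_swap q x y f :
  swap_horner q f = 0 -> swap_horner q (swap x y f) = 0.
Proof.
move=> qf; have -> : swap x y f = lshift_ffun (tperm x y) f by apply/ffunP => s; rewrite !ffunE.
by rewrite swap_horner_lshift qf; apply/ffunP => s; rewrite !ffunE.
Qed.

Lemma swap_horner_is_linear q : linear (swap_horner q).
Proof.
move=> a f g; apply/ffunP => s.
by rewrite /swap_horner linearP /= mulmxDl -scalemxAl !ffunE !mxE.
Qed.

HB.instance Definition _ q :=
  GRing.isLinear.Build R V V *:%R (swap_horner q) (swap_horner_is_linear q).

Lemma swap_horner_eq0 q f :
  (swap_horner q f == 0) = (rowf f *m horner_mx swap_mx q == 0).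
Proof. by rewrite -rowf_eq0 unrowfK. Qed.

(** The maximum over [k <= r] makes the eigenvalue bound monotone in the size of the invariance
    set. *)
Definition shape_bound r := \max_(k < r.+1) minn (n * k) (k ^ 2 + (n - k) ^ 2).

Lemma swap_mx_eigenvector (S : V -> Prop) f : (0 < n)%N ->
  swap_closed setT S -> S f -> f != 0 ->
  exists g A (m : nat) (a := m%:R - (n ^ 2)%:R : R),
    [/\ [/\ S g, g != 0 & swap_inv A g],
        rowf g *m swap_mx = a *: rowf g, (m <= 2 * n ^ 2)%N &
        a <= (shape_bound #|A|)%:R].
Proof.
move=> n0 SD Sf f0.
have [g [A [m [[Sg g0 _ gA] gE m1 m2 _]]]] := swap_sum_eigenvector SD Sf f0.
rewrite cardsT card_ord in gE m1 m2.
have leAn : (#|A| <= n)%N by rewrite -[n in leqRHS]card_ord max_card.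
exists g, A, m; split=> //.
- by rewrite rowf_swap_mx gE linearZ.
- by have := leq_mul (leqnn n) leAn; rewrite -!mulnn in m1 *; lia.
rewrite lerBlDr -natrD ler_nat.
have : (m - n ^ 2 <= minn (n * #|A|) (#|A| ^ 2 + (n - #|A|) ^ 2))%N by lia.
have := @leq_bigmax _ (fun k : 'I_(#|A|.+1) => minn (n * k) (k ^ 2 + (n - k) ^ 2)) ord_max.
by rewrite /shape_bound /=; lia.
Qed.

Lemma shape_bound_mono (r s : nat) :
  (r <= s)%N -> (shape_bound r <= shape_bound s)%N.
Proof.
move=> rs; apply/bigmax_leqP => k _.
exact: (leq_bigmax (widen_ord (rs : (r < s.+1)%N) k)).
Qed.

Lemma shape_bound_le_mul r : (shape_bound r <= n * r)%N.
Proof.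
apply/bigmax_leqP => k _; apply: leq_trans (geq_minl _ _) _.
by rewrite leq_mul2l -ltnS ltn_ord orbT.
Qed.

(** For k between j and n - j, convexity bounds k^2 + (n - k)^2 by its value at the endpoints; for k
    < j the bound n k is already small enough. *)
Lemma shape_bound_le_sqr j : (4 * j <= n)%N ->
  (shape_bound (n - j) <= (n - j) ^ 2 + j ^ 2)%N.
Proof.
move=> jn; apply/bigmax_leqP => -[k /=]; rewrite ltnS => kj _.
have [r rE] : exists r, n = (r + j)%N by exists (n - j)%N; lia.
rewrite rE addnK in kj jn *.
have [jk|kltj] := leqP j k.
  apply: leq_trans (geq_minr _ _) _.
  have [u uE] : exists u, r = (k + u)%N by exists (r - k)%N; lia.
  have [v vE] : exists v, k = (j + v)%N by exists (k - j)%N; lia.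
  by rewrite uE vE -!mulnn (_ : _ - _ = j + u)%N; lia.
apply: leq_trans (geq_minl _ _) _.
have [u uE] : exists u, r = (3 * j + u)%N by exists (r - 3 * j)%N; lia.
have := leq_mul (leqnn (r + j)) (ltnW kltj).
by rewrite uE -!mulnn; lia.
Qed.

Lemma uniq_shifted_iota b c : uniq [seq k%:R - b :> R | k <- iota 0 c].
Proof.
rewrite map_inj_uniq ?iota_uniq // => k l /addIr/eqP.
by rewrite eqr_nat => /eqP.
Qed.

(** [swap_mx_eigenvector] is applied to three spaces: the image of a polynomial in K
    (diagonalizability), a kernel (no eigenvalue above n^2), and a kernel cut down by the vanishing
    of the cylinder sums on n - r positions (counting). In the last one an invariance set has fewer
    than r elements. *)
Theorem swap_mx_spectrum : (0 < n)%N ->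
  exists P (d : 'rV[R]_nperms.+1),
    [/\ P \in unitmx, P *m swap_mx = diag_mx d *m P,
        forall i, d 0 i <= (n ^ 2)%:R &
        forall r, (0 < r <= n)%N ->
          (#|[set i | ((shape_bound r.-1)%:R < d 0 i)%R]| <=
             'C(n, n - r) * n ^ (n - r))%N].
Proof.
move=> n0.
have [p p0|P [d [Pu PK]]] :=
    symmetric_diagonalizable (uniq_shifted_iota (n ^ 2)%:R (2 * n ^ 2).+1) tr_swap_mx.
  have [v v0] : exists v : 'rV_nperms.+1, v *m horner_mx swap_mx p != 0.
    by case/rowV0Pn: p0 => w /submxP[v ->] v0; exists v.
  pose S g := exists h, g = swap_horner p h.
  have [|||g [A [m [[[h ->] g0 _] gE m1 _]]]] :=
      @swap_mx_eigenvector S (swap_horner p (unrowf v)) n0.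
  - split=> [a _ _ [h1 ->] [h2 ->]|x y _ _ _ [h ->]].
      by exists (a *: h1 + h2); rewrite linearP.
    exists (swap x y h).
    have swE f : swap x y f = lshift_ffun (tperm x y) f.
      by apply/ffunP => s; rewrite !ffunE.
    by rewrite !swE swap_horner_lshift.
  - by exists (unrowf v).
  - by rewrite swap_horner_eq0 unrowfK.
  exists (rowf h), (m%:R - (n ^ 2)%:R); split.
  - by apply/mapP; exists m => //; rewrite mem_iota; lia.
  - by rewrite -swap_horner_eq0.
  - by rewrite unrowfK in gE.
exists P, d; split=> //.
  have: (#|[set i | ((n ^ 2)%:R < d 0 i)%R]| <= 0)%N.
    apply: (@card_eigenvalues_gt _ _ swap_mx P d 0%N 0) => // q v v0 _ vq.
    pose S g := swap_horner q g = 0.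
    have [|||g [A [m [[Sg g0 _] gE _ ma]]]] := @swap_mx_eigenvector S (unrowf v) n0.
    - split=> [a h1 h2|x y h _ _]; last exact: swap_horner_swap.
      by rewrite /S linearP /= => -> ->; rewrite scaler0 addr0.
    - by apply/eqP; rewrite swap_horner_eq0 unrowfK vq.
    - by rewrite -rowf_eq0 unrowfK.
    exists (rowf g), (m%:R - (n ^ 2)%:R); split; rewrite ?rowf_eq0 //.
      by apply/eqP; rewrite -swap_horner_eq0; apply/eqP.
    apply: le_trans ma _; rewrite ler_nat; apply: leq_trans (shape_bound_le_mul _) _.
    by rewrite -mulnn leq_mul2l -[X in (_ <= X)%N]card_ord max_card orbT.
  rewrite leqn0 cards_eq0 => /eqP/setP d0 i.
  by move: (d0 i); rewrite !inE leNgt => ->.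
move=> r /andP[r0 rn].
(* One linear constraint per set of n - r positions and word of prescribed values. Words with
   repeated values give empty sums and only enlarge the count. *)
pose J : finType := ({I : {set 'I_n} | #|I| == (n - r)%N} * (n - r).-tuple 'I_n)%type.
have cardJ : #|J| = ('C(n, n - r) * n ^ (n - r))%N.
  rewrite card_prod card_tuple card_ord card_sig; congr (_ * _)%N.
  by rewrite -[n in 'C(n, _)]card_ord -card_draws cardsE.
rewrite -cardJ.
pose agree (w : J) (t : T) : bool := [seq t x | x <- enum (val w.1)] == val w.2.
pose C : 'M[R]_(nperms.+1, #|J|) :=
  \matrix_(i, k) (agree (enum_val k) (perm_of i))%:R.
apply: (@card_eigenvalues_gt _ _ swap_mx P d _ C) => // q v v0 vC vq.
pose S g := swap_horner q g = 0 /\ cylinder_null (n - r) g.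
have [|||g [A [m [[[Sg gr] g0 gA] gE _ ma]]]] := @swap_mx_eigenvector S (unrowf v) n0.
- split=> [a h1 h2|x y h _ _].
    move=> [qh1 h1r] [qh2 h2r]; split; last exact: cylinder_nullD.
    by rewrite linearP /= qh1 qh2 scaler0 addr0.
  by move=> [qh hr]; split; [exact: swap_horner_swap|exact: cylinder_null_swap].
- split; first by apply/eqP; rewrite swap_horner_eq0 unrowfK vq.
  move=> I s /eqP Ir.
  have as_ : size [seq s x | x <- enum I] == (n - r)%N by rewrite size_map -cardE.
  pose w : J := (exist _ I Ir, Tuple as_).
  move/rowP/(_ (enum_rank w)): vC.
  rewrite !mxE => <-; rewrite /cylinder_sum.
  have vE i : v 0 i = unrowf v (perm_of i) by rewrite ffunE perm_ofK.
  under [RHS]eq_bigr do rewrite mxE enum_rankK vE.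
  rewrite (sum_perm_of (fun t => unrowf v t * (agree w t)%:R)) big_mkcond /=.
  apply: eq_bigr => t _; rewrite (_ : [forall _ in _, _] = agree w t).
    by case: (agree w t); rewrite ?mulr1 ?mulr0.
  apply/forall_inP/eqP => [ts|/eq_in_map ts i iI].
    by apply/eq_in_map => i; rewrite mem_enum => /ts/eqP.
  by rewrite ts ?mem_enum.
- by rewrite -rowf_eq0 unrowfK.
exists (rowf g), (m%:R - (n ^ 2)%:R); split; rewrite ?rowf_eq0 //.
  by apply/eqP; rewrite -swap_horner_eq0; apply/eqP.
apply: le_trans ma _; rewrite ler_nat; apply: shape_bound_mono.
rewrite -ltnS prednK // ltnNge; apply: contraNN g0 => rA; apply/eqP.
exact: (@cylinder_null_swap_inv r A).
Qed.

(** A Plancherel formula without characters: the rows of the symmetric matrix q(K) are translates of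
    one function, so its squared entries sum to n! times the left-hand side, and also to the trace
    of q(K)^2. *)
Lemma sum_swap_horner_sqr P (d : 'rV[R]_nperms.+1) q :
  P \in unitmx -> P *m swap_mx = diag_mx d *m P ->
  \sum_s swap_horner q [ffun t => (t == 1%g)%:R] s ^+ 2 =
    (n`!%:R)^-1 * \sum_i q.[d 0 i] ^+ 2.
Proof.
move=> Pu PK; set M := horner_mx swap_mx q; set f := swap_horner _ _.
have Msym : M^T = M.
  rewrite /M; elim/poly_ind: (q) => [|p b IHp]; first by rewrite rmorph0 linear0.
  rewrite rmorphD rmorphM /= horner_mx_X horner_mx_C linearD /= tr_scalar_mx.
  rewrite trmx_mul tr_swap_mx IHp; congr (_ + _).
  by have := comm_horner_mx2 swap_mx 'X p; rewrite horner_mx_X.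
have ME i j : M i j = f ((perm_of i)^-1 * perm_of j)%g.
  transitivity ((delta_mx 0 i *m M : 'rV_nperms.+1) 0 j); first by rewrite -rowE mxE.
  transitivity (lshift_ffun (perm_of i)^-1%g f (perm_of j)); last by rewrite ffunE.
  rewrite -swap_horner_lshift ffunE perm_ofK; congr ((_ *m _) 0 j).
  apply/rowP => k; rewrite !mxE !ffunE eqxx /=; congr (_%:R).
  by rewrite -eq_mulVg1 (inj_eq (can_inj perm_ofK)) eq_sym.
have trM : \tr (M *m M) = \sum_i q.[d 0 i] ^+ 2.
  have -> : M *m M = horner_mx swap_mx (q * q) by rewrite rmorphM.
  have PM : P *m horner_mx swap_mx (q * q) = diag_mx (\row_i (q * q).[d 0 i]) *m P.
    apply/row_matrixP => i; rewrite !row_mul row_diag_mx mxE -scalemxAl -rowE.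
    apply: mulmx_horner_eigen; rewrite -row_mul PK row_mul row_diag_mx.
    by rewrite -scalemxAl -rowE.
  rewrite -[horner_mx _ _]mul1mx -(mulVmx Pu) -mulmxA PM mxtrace_mulC.
  rewrite -mulmxA mulmxV // mulmx1.
  by rewrite mxtrace_diag; apply: eq_bigr => i _; rewrite mxE hornerM expr2.
rewrite -trM -[in X in \tr (_ *m X)]Msym /mxtrace.
have fact0 : n`!%:R != 0 :> R by rewrite pnatr_eq0 -lt0n fact_gt0.
apply: (mulfI fact0); rewrite mulrA divff // mul1r.
transitivity (\sum_(i < nperms.+1) \sum_s f s ^+ 2).
  by rewrite mulr_natl sumr_const card_ord card_perms card_Sn.
apply: eq_bigr => i _; rewrite mxE.
under [RHS]eq_bigr do rewrite mxE -expr2 ME.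
rewrite (sum_perm_of (fun s => f ((perm_of i)^-1 * s)%g ^+ 2)).
by rewrite (reindex_inj (mulgI (perm_of i)^-1%g)).
Qed.

End SwapMatrix.

(** * Uniformity of the labels *)

Section PairedShuffleWords.
Variables (R : realType) (gT : finGroupType) (n : nat).
Notation W := (wreath gT n).
Notation T := {perm 'I_n}.
Implicit Types (a b c : W) (f : W -> R) (p q r i : 'I_n) (g h k : gT).

(** For [p = q] the first test wins: the element is a loop, carrying the single label [g] at [p]. *)
Definition shuffle_elt p q g : W :=
  Wreath [ffun i => if i == p then g else if i == q then g^-1 else 1]%g (tperm p q).

Definition label_elt p g : W := Wreath [ffun i => if i == p then g else 1]%g 1%g.

Lemma wvecM b a i : wvec (b * a)%g i = (wvec b i * wvec a ((wperm b)^-1 i))%g.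
Proof. by rewrite /mulg /= ffunE. Qed.

Lemma wpermM b a : wperm (b * a)%g = (wperm a * wperm b)%g.
Proof. by []. Qed.

Lemma wreathP a b : wvec a =1 wvec b -> wperm a = wperm b -> a = b.
Proof. by case: a b => [x s] [y t] /= /ffunP-> ->. Qed.

Lemma shuffle_elt_label p q g r h : (shuffle_elt p q g * label_elt r h =
  label_elt r h * shuffle_elt p q
    ((if r == p then h^-1 else 1) * g * (if r == q then h else 1)))%g.
Proof.
apply: wreathP => [i|]; last by rewrite !wpermM /= mul1g mulg1.
rewrite !wvecM /= !ffunE tpermV invg1 perm1.
have [->|ip] := eqVneq i p.
  rewrite tpermL (eq_sym r p) (eq_sym r q); case: (p == r); last by rewrite !mul1g.
  by rewrite !mulgA mulgV mul1g.
have [->|iq] := eqVneq i q.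
  rewrite tpermR (eq_sym r p) (eq_sym r q) !invMg.
  by case: (p == r); case: (q == r); rewrite ?invg1 ?invgK ?mul1g ?mulg1 ?mulKVg ?mulgA.
by rewrite tpermD 1?eq_sym // mul1g mulg1.
Qed.

(** Carries a label across an edge; averaged over [g] and [k] it identifies the label means at the
    two endpoints. *)
Lemma shuffle_elt_labelLR p q g k : p != q ->
  (shuffle_elt p q (g * k) * label_elt p (g * k * g^-1) =
   shuffle_elt p q g * label_elt q k)%g.
Proof.
move=> pq; apply: wreathP => [i|]; last by rewrite !wpermM.
rewrite !wvecM /= !ffunE tpermV.
have [->|ip] := eqVneq i p.
  by rewrite tpermL eqxx eq_sym (negbTE pq) mulg1.
have [->|iq] := eqVneq i q.
  by rewrite tpermR eqxx (negbTE pq) invMg mulg1 !mulgA mulgKV mulVg mul1g.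
by rewrite tpermD 1?eq_sym // (eq_sym p) (negbTE ip) (negbTE iq).
Qed.

Definition shuffle_step p q f a : R :=
  #|gT|%:R^-1 * \sum_g f ((shuffle_elt p q g)^-1 * a)%g.

Definition label_mean p f a : R :=
  #|gT|%:R^-1 * \sum_g f (label_elt p g * a)%g.

Lemma eq_shuffle_step p q f f' : f =1 f' -> shuffle_step p q f =1 shuffle_step p q f'.
Proof. by move=> ff a; congr (_ * _); apply: eq_bigr => g _; rewrite ff. Qed.

Lemma label_elt_mul p g h : (label_elt p g * label_elt p h = label_elt p (g * h))%g.
Proof.
apply: wreathP => [i|]; last by rewrite wpermM mulg1.
by rewrite wvecM /= !ffunE invg1 perm1; case: ifP; rewrite ?mulg1.
Qed.

Lemma label_elt1 p : label_elt p 1 = 1%g.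
Proof. by apply: wreathP => [i|//]; rewrite /= !ffunE if_same. Qed.

Lemma label_eltV p g : ((label_elt p g)^-1 = label_elt p g^-1)%g.
Proof. by apply/eqP; rewrite eq_invg_mul label_elt_mul mulgV label_elt1. Qed.

Lemma label_mean_label p f h a : label_mean p f (label_elt p h * a)%g = label_mean p f a.
Proof.
congr (_ * _); rewrite [RHS](reindex_inj (mulIg h)); apply: eq_bigr => g _.
by rewrite mulgA label_elt_mul.
Qed.

Lemma label_mean_step r p q f :
  label_mean r (shuffle_step p q f) =1 shuffle_step p q (label_mean r f).
Proof.
move=> a; rewrite /label_mean /shuffle_step -!mulr_sumr; congr (_ * (_ * _)).
rewrite [RHS]exchange_big; apply: eq_bigr => h _ /=.
pose u := if r == p then h else 1%g; pose v := if r == q then h^-1%g else 1%g.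
rewrite (reindex_inj (inj_comp (mulIg v) (mulgI u))); apply: eq_bigr => g _ /=.
congr (f _); rewrite !mulgA; congr (_ * _)%g.
rewrite -[label_elt r h]invgK label_eltV -!invMg; congr (_^-1)%g.
by rewrite shuffle_elt_label invgK.
Qed.

Lemma shuffle_step_label_mean p q f :
  shuffle_step p q (label_mean p f) =1 shuffle_step p q (label_mean q f).
Proof.
have [->//|pq] := eqVneq p q.
move=> a; rewrite /label_mean /shuffle_step -!mulr_sumr; congr (_ * (_ * _)).
transitivity (\sum_g \sum_k f ((shuffle_elt p q (g * k) * label_elt p (g * k * g^-1))^-1 * a)%g).
  rewrite [RHS]exchange_big.
  under [RHS]eq_bigr => k _.
    rewrite (reindex_inj (mulIg k^-1%g)) /=.
    under eq_bigr do rewrite mulgKV.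
    over.
  rewrite [RHS]exchange_big; apply: eq_bigr => g _ /=.
  rewrite (reindex_inj (inj_comp (mulgI g) (inj_comp (mulIg g^-1%g) invg_inj))) /=.
  apply: eq_bigr => k _; rewrite [in RHS]invMg label_eltV mulgA.
  congr (f (label_elt p _ * _ * _)%g).
  by rewrite !invMg !invgK !mulgA.
apply: eq_bigr => g _; rewrite [RHS](reindex_inj invg_inj).
apply: eq_bigr => k _.
by rewrite shuffle_elt_labelLR // invMg label_eltV !mulgA.
Qed.

Lemma shuffle_step_loop p f : shuffle_step p p f =1 label_mean p f.
Proof.
move=> a; congr (_ * _); rewrite (reindex_inj invg_inj); apply: eq_bigr => g _.
congr (f (_ * _)%g); rewrite -[g in RHS]invgK -label_eltV; congr (_^-1)%g.
apply: wreathP => [i|]; last exact: tperm1.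
by rewrite /= !ffunE; case: (i == p).
Qed.

Lemma label_mean_idem p f : label_mean p (label_mean p f) =1 label_mean p f.
Proof.
move=> a; rewrite {1}/label_mean (eq_bigr (fun=> label_mean p f a)) => [|g _].
  rewrite sumr_const mulrnAr -mulrnAl -mulr_natl mulfV ?mul1r //.
  by rewrite pnatr_eq0 -lt0n; apply/card_gt0P; exists 1%g.
exact: label_mean_label.
Qed.

Lemma eq_label_mean p f f' : f =1 f' -> label_mean p f =1 label_mean p f'.
Proof. by move=> ff a; congr (_ * _); apply: eq_bigr => g _; rewrite ff. Qed.

(** The head of the word is the most recent step, that is, the leftmost factor of the product. *)
Definition word_measure (w : seq ('I_n * 'I_n)) : W -> R :=
  foldr (fun e => shuffle_step e.1 e.2) (fun a => (a == 1%g)%:R) w.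

Lemma word_measure_cross w p q : (p, q) \in w ->
  label_mean p (word_measure w) =1 label_mean q (word_measure w).
Proof.
elim: w => //= e w IHw; rewrite inE => /orP[/eqP<-|/IHw eqw] a /=.
  by rewrite !label_mean_step shuffle_step_label_mean.
by rewrite !label_mean_step; exact: eq_shuffle_step.
Qed.

Lemma word_measure_loop w p : (p, p) \in w ->
  label_mean p (word_measure w) =1 word_measure w.
Proof.
elim: w => //= e w IHw; rewrite inE => /orP[/eqP<-|/IHw eqw] a /=.
  by rewrite (eq_label_mean _ (shuffle_step_loop _ _)) label_mean_idem shuffle_step_loop.
by rewrite label_mean_step; exact: eq_shuffle_step.
Qed.

(* A set of positions and its complement are crossed by the same edges, so    *)
(* only the smaller of the two is tested.                                     *)
Definition bad_word (w : seq ('I_n * 'I_n)) :=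
  all (fun e => e.1 != e.2) w ||
  [exists A : {set 'I_n}, (0 < #|A|)%N && (2 * #|A| <= n)%N &&
     all (fun e => (e.1 \in A) == (e.2 \in A)) w].

(** The positions whose label mean acts trivially include the loop and are closed under the edges of
    [w]. If some position were missing, this set or its complement would witness a bad word. *)
Lemma good_word_label w p : ~~ bad_word w ->
  label_mean p (word_measure w) =1 word_measure w.
Proof.
rewrite negb_or -has_predC => /andP[/hasP[[r r'] rw /= /negPn/eqP rr] noA].
rewrite -{}rr {r'} in rw.
pose A := [set q | `[< label_mean q (word_measure w) =1 word_measure w >]].
have crossA : all (fun e => (e.1 \in A) == (e.2 \in A)) w.
  apply/allP => -[u v] uvw /=; rewrite !inE; apply/eqP/asbool_equiv_eq.
  by split=> uw a; rewrite -uw (word_measure_cross uvw).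
have rA : r \in A by rewrite inE; apply/asboolP; exact: word_measure_loop.
suff : p \in A by rewrite inE => /asboolP.
apply: contraNT noA => pA; have cardA := cardsC A; rewrite card_ord in cardA.
have A0 : (0 < #|A|)%N by apply/card_gt0P; exists r.
have C0 : (0 < #|~: A|)%N by apply/card_gt0P; exists p; rewrite inE.
apply/existsP; have [A2|A2] := leqP (2 * #|A|)%N n; first by exists A; rewrite A0 A2.
have C2 : (2 * #|~: A| <= n)%N by lia.
exists (~: A); rewrite C0 C2 /=.
apply/allP => e /(allP crossA)/eqP eA; by rewrite !finset.in_setC eA.
Qed.

Lemma label_mean_fixed p f h a :
  label_mean p f =1 f -> f (label_elt p h * a)%g = f a.
Proof. by move=> fp; rewrite -fp label_mean_label fp. Qed.

(** Left multiplication by a label at one position where [x] and [y] differ removes that difference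
    without changing [f]. *)
Lemma labels_fixed f (x y : {ffun 'I_n -> gT}) (s : T) :
  (forall p, label_mean p f =1 f) -> f (Wreath x s) = f (Wreath y s).
Proof.
move=> fL; have [d] := ubnP #|[set i | x i != y i]|.
elim: d => // d IHd in x *; rewrite ltnS => led.
have [/eqP|] := posnP #|[set i | x i != y i]|.
  rewrite cards_eq0 => /eqP s0; congr (f (Wreath _ _)); apply/ffunP => i.
  by apply/eqP; move/setP/(_ i): s0; rewrite !inE => /negbFE.
case/card_gt0P => i; rewrite inE => xyi.
pose z := [ffun j => if j == i then y i else x j].
rewrite -(label_mean_fixed (y i * (x i)^-1)%g _ (fL i)).
have -> : (label_elt i (y i * (x i)^-1) * Wreath x s)%g = Wreath z s.
  apply: wreathP => [j|]; last by rewrite wpermM /= mulg1.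
  rewrite wvecM /= !ffunE invg1 perm1.
  by case: eqVneq => [->|_]; rewrite ?mulgKV ?mul1g.
apply: IHd; apply: leq_trans led; apply: proper_card; apply/properP; split.
  by apply/subsetP => j; rewrite !inE ffunE; case: (eqVneq j i) => [->|]; rewrite ?eqxx.
by exists i; rewrite !inE // ffunE !eqxx.
Qed.

End PairedShuffleWords.

(** * Convolution powers as averages over words of edges *)

Section TupleSums.
Variables (R : realType) (E : finType).

Lemma sum_tuple_cons (U : nmodType) k (F : seq E -> U) :
  \sum_(w : k.+1.-tuple E) F w = \sum_e \sum_(w : k.-tuple E) F (e :: w).
Proof.
rewrite pair_bigA (reindex (fun u : E * k.-tuple E => [tuple of u.1 :: u.2])) //=.
exists (fun w : k.+1.-tuple E => (thead w, [tuple of behead w])) => [[e w] _|w _] /=.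
  by congr (_, _); apply: val_inj.
by rewrite [in RHS](tuple_eta w); apply: val_inj.
Qed.

Lemma sum_all_tuple k (P : pred E) :
  \sum_(w : k.-tuple E) (all P w)%:R = #|P|%:R ^+ k :> R.
Proof.
elim: k => [|k IHk].
  rewrite (eq_bigr (fun=> 1)) => [|w _]; last by rewrite tuple0.
  by rewrite sumr_const card_tuple expn0 expr0.
rewrite (sum_tuple_cons _ (fun w => (all P w)%:R)) exprS -[in X in _ = X * _]sum1_card natr_sum.
rewrite mulr_suml [RHS]big_mkcond /=.
apply: eq_bigr => e _; case: ifPn => [Pe|/negbTE Pe].
  rewrite mul1r -IHk; apply: eq_bigr => w _.
  by rewrite (_ : P e = true).
rewrite big1 // => w _; by rewrite (_ : P e = false).
Qed.

End TupleSums.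

Section PairedShufflePowers.
Variables (R : realType) (gT : finGroupType) (n : nat).
Hypothesis n_gt0 : (0 < n)%N.
Notation W := (wreath gT n).
Notation T := {perm 'I_n}.
Notation Q := (@paired_shuffles R gT n).
Implicit Types (a b c : W) (f : W -> R) (p q r i : 'I_n) (g h : gT) (s : T).

Let cardG_neq0 : #|gT|%:R != 0 :> R.
Proof. by rewrite pnatr_eq0 -lt0n; apply/card_gt0P; exists 1%g. Qed.

Lemma shuffle_elt_eqP p q a :
  reflect (exists g, shuffle_elt p q g = a)
    [&& wperm a == tperm p q, (q != p) ==> (wvec a q == (wvec a p)^-1%g) &
       [forall i, (i != p) ==> (i != q) ==> (wvec a i == 1%g)]].
Proof.
apply: (iffP and3P) => [[/eqP aE /implyP aq /forallP a1]|[g <-]]; last first.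
  split=> //=; first by apply/implyP => qp; rewrite !ffunE eqxx (negbTE qp) eqxx.
  by apply/forallP => i; rewrite ffunE; case: (i == p); case: (i == q) => /=.
exists (wvec a p); apply: wreathP => [i|//]; rewrite ffunE.
have [->//|ip] := eqVneq i p; have [iq|iq] := eqVneq i q.
  by rewrite iq; rewrite iq in ip; apply/esym/eqP/aq.
by apply/esym/eqP; have := a1 i; rewrite ip iq.
Qed.

Lemma sum_shuffle_elt p q a :
  \sum_g (shuffle_elt p q g == a)%:R =
  [&& wperm a == tperm p q, (q != p) ==> (wvec a q == (wvec a p)^-1%g) &
     [forall i, (i != p) ==> (i != q) ==> (wvec a i == 1%g)]]%:R :> R.
Proof.
case: shuffle_elt_eqP => [[g <-]|aN]; last first.
  by rewrite big1 // => g _; case: eqP => // ga; case: aN; exists g.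
rewrite (bigD1 g) //= eqxx big1 ?addr0 // => h hg; case: eqP => // /(congr1 (@wvec _ _)).
by move=> /ffunP/(_ p); rewrite !ffunE eqxx => hE; rewrite hE eqxx in hg.
Qed.

(** Multiplicities explain the weights of [Q]: the identity arises from all n loops, a single
    nontrivial label from one loop, and a paired transposition from both (p, q) and (q, p). *)
Lemma paired_shufflesE a :
  Q a = (#|gT|%:R * n%:R ^+ 2)^-1 * \sum_p \sum_q \sum_g (shuffle_elt p q g == a)%:R.
Proof.
have n0 : n%:R != 0 :> R by rewrite pnatr_eq0 -lt0n.
under eq_bigr do under eq_bigr do rewrite sum_shuffle_elt.
rewrite /paired_shuffles; case: eqP => [s1|/eqP s1].
  have diag p : \sum_q [&& wperm a == tperm p q,
        (q != p) ==> (wvec a q == (wvec a p)^-1%g) &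
        [forall i, (i != p) ==> (i != q) ==> (wvec a i == 1%g)]]%:R =
      [forall i, (i != p) ==> (wvec a i == 1%g)]%:R :> R.
    rewrite (bigD1 p) //= big1 => [|q qp]; last first.
      case: eqP => //; rewrite s1 => /permP/(_ p); rewrite perm1 tpermL => pq.
      by rewrite pq eqxx in qp.
    rewrite s1 tperm1 !eqxx /= addr0; congr ((_ : bool)%:R).
    by apply: eq_forallb => i; case: (i != p).
  under eq_bigr do rewrite diag.
  have [x1|x1] := eqVneq (wvec a) [ffun=> 1%g].
    rewrite (eq_bigr (fun=> 1)) => [|p _]; last first.
      by case: forallP => // -[] i; rewrite x1 ffunE eqxx implybT.
    by rewrite sumr_const card_ord; field; rewrite n0 cardG_neq0.
  have one p : [forall i, (i != p) ==> (wvec a i == 1%g)] = ([set i | wvec a i != 1%g] == [set p]).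
    apply/forallP/eqP => [ap|/setP ap i].
      apply/eqP; rewrite eqEsubset; apply/andP; split.
        apply/subsetP => i; rewrite !inE; apply: contraNT => ip.
        by have := ap i; rewrite ip.
      rewrite finset.sub1set inE; apply: contra x1 => /eqP xp; apply/eqP/ffunP => i.
      rewrite ffunE; have [->//|ip] := eqVneq i p.
      by have := ap i; rewrite ip => /eqP.
    by have := ap i; rewrite !inE => <-; rewrite negbK implybb.
  under eq_bigr do rewrite one.
  case: ifPn => [/cards1P[p ->]|xN].
    rewrite (bigD1 p) //= eqxx big1 ?addr0 ?mulr1 ?div1r // => q qp.
    by case: eqP => // /finset.set1_inj pq; rewrite pq eqxx in qp.
  rewrite big1 ?mulr0 // => p _; case: eqP => // xp.
  by rewrite /one_nonid xp cards1 in xN.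
case: ifPn => [/existsP[p /existsP[q /and4P[pq /eqP sE xq /forallP x1]]]|xN]; last first.
  rewrite big1 ?mulr0 // => p _; rewrite big1 // => q _.
  case: eqP => // sE; have pq : p != q by apply: contraNneq s1 => pq; rewrite sE pq tperm1.
  rewrite /=; case: (boolP (_ && _)) => // /andP[xq x1]; case/negP: xN.
  apply/existsP; exists p; apply/existsP; exists q; rewrite pq sE eqxx x1.
  by move: xq; rewrite eq_sym pq /= => ->.
have sum2 (F : 'I_n -> 'I_n -> bool) : F p q -> F q p ->
    (forall u v, F u v -> (u, v) = (p, q) \/ (u, v) = (q, p)) ->
    \sum_u \sum_v (F u v)%:R = 2 :> R.
  move=> Fpq Fqp Fuv; rewrite pair_bigA /= (bigD1 (p, q)) // (bigD1 (q, p)) /=; last first.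
    by apply: contraNneq pq => -[->].
  rewrite Fpq Fqp big1 ?addr0 // => -[u v] /andP[/= uv1 uv2].
  case: (boolP (F u v)) => // /Fuv[] e; first by rewrite e eqxx in uv1.
  by rewrite e eqxx in uv2.
rewrite (sum2 (fun u v => [&& wperm a == tperm u v,
    (v != u) ==> (wvec a v == (wvec a u)^-1%g) &
    [forall i, (i != u) ==> (i != v) ==> (wvec a i == 1%g)]])).
- exact: mulrC.
- rewrite sE eqxx xq implybT; exact/forallP.
- rewrite sE tpermC eqxx pq /= (eqP xq) invgK eqxx.
  by apply/forallP => i; have := x1 i; case: (i != p); case: (i != q).
move=> u v /and3P[/eqP suv _ _]; rewrite sE in suv.
have uv : u != v by apply: contraNneq s1 => e; rewrite sE suv e tperm1.
have : tperm p q u = v by rewrite suv tpermL.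
case: tpermP => [->->|->->|_ _ e].
- by left.
- by right.
- by rewrite e eqxx in uv.
Qed.

Lemma convolution_shuffles f a :
  convolution Q f a = (n%:R ^+ 2)^-1 * \sum_p \sum_q shuffle_step p q f a.
Proof.
rewrite /convolution; under eq_bigr do rewrite paired_shufflesE -mulrA mulr_suml.
rewrite -mulr_sumr invfM [X in X * _]mulrC -mulrA; congr (_ * _).
rewrite exchange_big mulr_sumr; apply: eq_bigr => p _ /=.
under eq_bigr do rewrite mulr_suml.
rewrite exchange_big mulr_sumr; apply: eq_bigr => q _ /=.
congr (_ * _); under eq_bigr do rewrite mulr_suml.
rewrite exchange_big; apply: eq_bigr => g _ /=.
rewrite (bigD1 ((shuffle_elt p q g)^-1 * a)%g) //= big1 => [|b ba].
  by rewrite invMg invgK mulgA mulgV mul1g eqxx mul1r addr0.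
case: eqP => [e|_]; last by rewrite mul0r.
by rewrite e invMg invgK mulgKV eqxx in ba.
Qed.

Lemma convolution_pow_words k a :
  convolution_pow Q k a =
    (n%:R ^+ 2)^-1 ^+ k * \sum_(w : k.-tuple ('I_n * 'I_n)) @word_measure R gT n w a.
Proof.
elim: k a => [|k IHk] a.
  rewrite (eq_bigr (fun=> (a == 1%g)%:R)) => [|w _]; last by rewrite tuple0.
  by rewrite sumr_const card_tuple expn0 expr0 mul1r.
rewrite -[LHS]/(convolution Q (convolution_pow Q k) a) convolution_shuffles.
rewrite (sum_tuple_cons _ (fun w => @word_measure R gT n w a)) (exprS _ k) -mulrA; congr (_ * _).
rewrite pair_bigA mulr_sumr; apply: eq_bigr => e _ /=.
rewrite (eq_shuffle_step _ _ IHk) /shuffle_step -mulr_sumr mulrCA; congr (_ * _).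
by rewrite exchange_big mulr_sumr.
Qed.

Definition perm_marginal f s : R := \sum_x f (Wreath x s).

Lemma sum_wreath (F : W -> R) : \sum_a F a = \sum_s \sum_x F (Wreath x s).
Proof.
rewrite pair_bigA (reindex (fun u : T * {ffun 'I_n -> gT} => Wreath u.2 u.1)) //.
by exists (fun a => (wperm a, wvec a)) => [[]|[]].
Qed.

Lemma perm_marginal_step p q f s :
  perm_marginal (shuffle_step p q f) s = perm_marginal f (s * tperm p q)%g.
Proof.
rewrite /perm_marginal /shuffle_step -mulr_sumr exchange_big /=.
rewrite (eq_bigr (fun=> perm_marginal f (s * tperm p q)%g)) => [|g _]; last first.
  rewrite /perm_marginal.
  pose b := ((shuffle_elt p q g)^-1)%g.
  rewrite [RHS](reindex_inj (h := fun x => wvec (b * Wreath x s)%g)) /=; last first.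
    move=> x y /= exy; suff [] : Wreath x s = Wreath y s by [].
    apply: (mulgI b); apply: wreathP => [i|//]; exact: (congr1 (fun z : {ffun _} => z i) exy).
  apply: eq_bigr => x _; congr f; apply: wreathP => //.
  by rewrite wpermM /b /= tpermV.
by rewrite sumr_const -[perm_marginal _ _ *+ _]mulr_natl mulrA mulVf // mul1r.
Qed.

Lemma word_measure_ge0 w a : 0 <= @word_measure R gT n w a.
Proof.
elim: w a => /= [|e w IHw] a; first by rewrite ler0n.
by rewrite mulr_ge0 ?invr_ge0 ?ler0n // sumr_ge0.
Qed.

Lemma sum_word_measure w : \sum_a @word_measure R gT n w a = 1.
Proof.
elim: w => /= [|e w IHw]; first by rewrite (bigD1 1%g) //= eqxx big1 ?addr0 // => a /negbTE ->.
rewrite -mulr_sumr exchange_big /= (eq_bigr (fun=> 1)) => [|g _].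
  by rewrite sumr_const mulVf.
by rewrite -[RHS]IHw [RHS](reindex_inj (mulgI (shuffle_elt e.1 e.2 g)^-1%g)).
Qed.

Lemma sum_wreath_uniform (P : T -> R) :
  \sum_(a : W) (#|gT|%:R ^+ n)^-1 * P (wperm a) = \sum_s P s.
Proof.
rewrite sum_wreath; apply: eq_bigr => s _ /=.
rewrite sumr_const card_ffun card_ord -mulrnAl -[_^-1 *+ _]mulr_natl natrX.
by rewrite mulfV ?mul1r // expf_neq0.
Qed.

(** For a good word the two measures coincide; for a bad one both still have total mass 1. *)
Lemma word_measure_marginal w :
  \sum_a `|@word_measure R gT n w a -
           (#|gT|%:R ^+ n)^-1 * perm_marginal (@word_measure R gT n w) (wperm a)|
    <= 2 * (bad_word w)%:R.
Proof.
have [bw|gw] := boolP (bad_word w); last first.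
  rewrite mulr0 big1 // => -[x s] _ /=; apply/normr0_eq0; apply/eqP.
  rewrite normr_eq0 normr_eq0 subr_eq0; apply/eqP.
  rewrite /perm_marginal (eq_bigr (fun=> @word_measure R gT n w (Wreath x s))) => [|y _].
    rewrite sumr_const card_ffun card_ord mulrnAr -mulrnAl.
    rewrite -[_^-1 *+ _]mulr_natl natrX mulfV ?mul1r //.
    by rewrite expf_neq0.
  by apply: labels_fixed => p; exact: good_word_label.
rewrite mulr1; apply: (@le_trans _ _ (\sum_a (@word_measure R gT n w a +
    (#|gT|%:R ^+ n)^-1 * perm_marginal (@word_measure R gT n w) (wperm a)))).
  apply: ler_sum => a _; apply: le_trans (ler_normB _ _) _.
  rewrite !ger0_norm ?word_measure_ge0 // mulr_ge0 ?invr_ge0 ?exprn_ge0 ?ler0n //.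
  by rewrite sumr_ge0 // => x _; exact: word_measure_ge0.
rewrite big_split /= sum_wreath_uniform sum_word_measure.
by rewrite -sum_wreath sum_word_measure.
Qed.

End PairedShufflePowers.

(** * The random transposition marginal and the probability of bad words *)

Section PermutationWalk.
Variables (R : realType) (gT : finGroupType) (n : nat).
Hypothesis n_gt0 : (0 < n)%N.
Notation W := (wreath gT n).
Notation T := {perm 'I_n}.
Notation Q := (@paired_shuffles R gT n).

Definition perm_walk k : {ffun T -> R} :=
  [ffun s => perm_marginal (convolution_pow Q k) s].

Definition perm_unit : {ffun T -> R} := [ffun s => (s == 1%g)%:R].

Lemma perm_walk0 : perm_walk 0 = perm_unit.
Proof.
apply/ffunP => s; rewrite !ffunE /perm_marginal /=.
have [->|s1] := eqVneq s 1%g; last first.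
  by rewrite big1 // => x _; case: eqP => // -[_ e]; rewrite e eqxx in s1.
rewrite (bigD1 [ffun=> 1%g]) //= big1 => [|x x1]; last first.
  by case: eqP => // -[e]; rewrite e eqxx in x1.
by rewrite addr0 (_ : _ == _ = true) //; apply/eqP.
Qed.

Lemma perm_walkS k :
  perm_walk k.+1 = (n%:R ^+ 2)^-1 *: swap_sum setT (perm_walk k).
Proof.
apply/ffunP => s; rewrite !ffunE swap_sumTE /perm_marginal.
under eq_bigr => x _ do rewrite -[convolution_pow _ _ _]
  /(convolution Q (convolution_pow Q k) (Wreath x s)) (convolution_shuffles n_gt0).
rewrite -mulr_sumr exchange_big; congr (_ * _); apply: eq_bigr => p _ /=.
rewrite exchange_big; apply: eq_bigr => q _ /=.
by rewrite ffunE -perm_marginal_step.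
Qed.

Lemma perm_walk_horner k :
  perm_walk k = swap_horner ((n%:R ^+ 2)^-1 ^+ k *: 'X^k) perm_unit.
Proof.
apply: (can_inj (@rowfK R n)); rewrite unrowfK linearZ /=.
rewrite rmorphXn /= horner_mx_X -scalemxAr.
elim: k => [|k IHk]; first by rewrite perm_walk0 !expr0 scale1r mulmx1.
rewrite perm_walkS linearZ /= -rowf_swap_mx IHk -scalemxAl scalerA -exprS.
by rewrite -mulmxA [swap_mx R n ^+ _.+1]exprSr.
Qed.

(** Union bound over the two ways of being bad: n^2 - n pairs are not loops, and
    [#|A| ^ 2 + (n - #|A|) ^ 2] pairs do not cross the boundary of [A]. *)
Lemma shuffle_pow_dist k :
  \sum_(a : W) `|convolution_pow Q k a - (#|gT|%:R ^+ n)^-1 * perm_walk k (wperm a)|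
  <= 2 * (((n ^ 2 - n)%N%:R / n%:R ^+ 2) ^+ k +
     \sum_(A : {set 'I_n} | (0 < #|A|)%N && (2 * #|A| <= n)%N)
        ((#|A| ^ 2 + (n - #|A|) ^ 2)%N%:R / n%:R ^+ 2) ^+ k).
Proof.
pose mu (w : seq ('I_n * 'I_n)) := @word_measure R gT n w.
have n2 : 0 <= (n%:R ^+ 2)^-1 ^+ k :> R by rewrite exprn_ge0 // invr_ge0 exprn_ge0.
apply: (@le_trans _ _ ((n%:R ^+ 2)^-1 ^+ k *
   \sum_(w : k.-tuple ('I_n * 'I_n)) 2 * (bad_word w)%:R)).
  apply: (@le_trans _ _ (\sum_a (n%:R ^+ 2)^-1 ^+ k *
      \sum_(w : k.-tuple ('I_n * 'I_n)) `|mu w a -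
        (#|gT|%:R ^+ n)^-1 * perm_marginal (mu w) (wperm a)|)).
    apply: ler_sum => a _; rewrite ffunE /perm_marginal.
    under [X in _ - _ * X]eq_bigr do rewrite (convolution_pow_words R n_gt0).
    rewrite (convolution_pow_words R n_gt0) -mulr_sumr mulrCA -mulrBr normrM.
    rewrite (ger0_norm n2) ler_wpM2l //.
    rewrite exchange_big mulr_sumr /= -sumrB; exact: ler_norm_sum.
  rewrite -mulr_sumr ler_wpM2l // exchange_big; apply: ler_sum => w _.
  exact: word_measure_marginal.
rewrite -mulr_sumr mulrCA ler_pM2l //.
have cardE (P : pred ('I_n * 'I_n)) m : #|P| = m ->
    (m%:R / n%:R ^+ 2) ^+ k = (n%:R ^+ 2)^-1 ^+ k *
      \sum_(w : k.-tuple ('I_n * 'I_n)) (all P w)%:R :> R.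
  by move=> <-; rewrite sum_all_tuple expr_div_n mulrC exprVn.
rewrite (@cardE (fun e => e.1 != e.2)); last first.
  rewrite -[LHS](addKn #|[pred e : 'I_n * 'I_n | e.1 == e.2]|).
  rewrite (cardC [pred e : 'I_n * 'I_n | e.1 == e.2]) card_prod card_ord mulnn.
  congr (_ - _)%N; rewrite -[RHS]card_ord -(card_image (f := fun i : 'I_n => (i, i))).
    apply: eq_card => -[i j]; rewrite inE /=; apply/eqP/imageP => [->|[l _ [-> ->]]//].
    by exists j.
  by move=> i j [].
rewrite (eq_bigr (fun A : {set 'I_n} => (n%:R ^+ 2)^-1 ^+ k *
    \sum_(w : k.-tuple ('I_n * 'I_n))
       (all (fun e => (e.1 \in A) == (e.2 \in A)) w)%:R)) => [|A _]; last first.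
  apply: cardE; have cA : #|~: A| = (n - #|A|)%N by rewrite cardsCs finset.setCK card_ord.
  rewrite -!mulnn -cA -!cardsX -cardsUI.
  rewrite (_ : _ :&: _ = finset.set0) ?cards0 ?addn0; last first.
    by apply/setP => -[i j]; rewrite !inE /=; case: (i \in A); case: (j \in A).
  apply: eq_card => -[i j]; rewrite !inE /=.
  by rewrite [LHS]/in_mem /=; case: (i \in A); case: (j \in A).
rewrite -mulr_sumr -mulrDr ler_wpM2l // exchange_big -big_split.
apply: ler_sum => w _ /=; rewrite /bad_word.
case: (boolP (all (fun e => e.1 != e.2) w)) => [_|_] /=.
  by rewrite lerDl sumr_ge0 // => A _; exact: ler0n.
rewrite add0r; case: existsP => [[A /andP[A0 Aw]]|_]; last first.
  by rewrite sumr_ge0 // => A _; exact: ler0n.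
by rewrite (bigD1 A) //= Aw lerDl sumr_ge0.
Qed.

Lemma perm_walk_ge0 k s : 0 <= perm_walk k s.
Proof.
rewrite ffunE sumr_ge0 // => x _; rewrite convolution_pow_words //.
rewrite mulr_ge0 ?exprn_ge0 ?invr_ge0 ?exprn_ge0 ?ler0n // sumr_ge0 // => w _.
exact: word_measure_ge0.
Qed.

Lemma shuffle_pow_ge0 k a : 0 <= convolution_pow Q k a.
Proof.
rewrite convolution_pow_words //.
rewrite mulr_ge0 ?exprn_ge0 ?invr_ge0 ?exprn_ge0 ?ler0n // sumr_ge0 // => w _.
exact: word_measure_ge0.
Qed.

Lemma sum_shuffle_pow k : \sum_a convolution_pow Q k a = 1.
Proof.
under eq_bigr do rewrite convolution_pow_words //.
rewrite -mulr_sumr exchange_big /= (eq_bigr (fun=> 1)) => [|w _].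
  rewrite sumr_const card_tuple card_prod card_ord -mulr_natl mulr1 natrX natrM -expr2.
  by rewrite -exprMn mulVf ?expr1n // expf_neq0 // pnatr_eq0 -lt0n.
exact: sum_word_measure.
Qed.

Lemma sum_perm_walk k : \sum_s perm_walk k s = 1.
Proof.
rewrite -(sum_shuffle_pow k) sum_wreath; apply: eq_bigr => s _.
by rewrite ffunE.
Qed.

End PermutationWalk.

(** * Passing to continuous time *)

Section PoissonSeries.
Variable R : realType.
Implicit Types (t x : R) (u v : R^nat).

Definition poisson_sum t u : R^nat :=
  series (fun k => expR (- t) * (t ^+ k / k`!%:R) * u k).

Lemma poisson_sumE t u N :
  poisson_sum t u N = \sum_(k < N) expR (- t) * (t ^+ k / k`!%:R) * u k.
Proof. by rewrite /poisson_sum /series /= big_mkord. Qed.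

Lemma poisson_sum_powers t x :
  (poisson_sum t (fun k => x ^+ k) @ \oo --> expR (- t * (1 - x)))%classic.
Proof.
have -> : poisson_sum t (fun k => x ^+ k) =
    (fun N => expR (- t) * series (exp_coeff (t * x)) N).
  apply/funext => N; rewrite /poisson_sum /series /= mulr_sumr; apply: eq_bigr => k _.
  by rewrite /exp_coeff /= exprMn; ring.
rewrite mulrBr mulr1 mulNr opprK expRD; apply: cvgMr.
exact: is_cvg_series_exp_coeff.
Qed.

Lemma poisson_weight_ge0 t k : 0 <= t -> 0 <= expR (- t) * (t ^+ k / k`!%:R).
Proof.
by move=> t0; rewrite mulr_ge0 ?expR_ge0 // divr_ge0 ?exprn_ge0 ?ler0n.
Qed.

Lemma poisson_sum_powers_le t x N : 0 <= t -> 0 <= x ->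
  poisson_sum t (fun k => x ^+ k) N <= expR (- t * (1 - x)).
Proof.
move=> t0 x0; rewrite -(cvg_lim _ (@poisson_sum_powers t x)) //.
apply: nondecreasing_cvgn_le.
  by apply: nondecreasing_series => k _ _; rewrite mulr_ge0 ?poisson_weight_ge0 ?exprn_ge0.
by apply/cvg_ex; eexists; exact: poisson_sum_powers.
Qed.

Lemma poisson_sum_cvg t u : 0 <= t -> (forall k, 0 <= u k <= 1) ->
  cvgn (poisson_sum t u).
Proof.
move=> t0 u01; apply: (@series_le_cvg _ _
    (fun k => expR (- t) * (t ^+ k / k`!%:R) * 1 ^+ k)) => [k|k|k|].
- by rewrite mulr_ge0 ?poisson_weight_ge0 //; case/andP: (u01 k).
- by rewrite mulr_ge0 ?poisson_weight_ge0 // expr1n.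
- by rewrite ler_wpM2l ?poisson_weight_ge0 // expr1n; case/andP: (u01 k).
- by apply/cvg_ex; eexists; exact: poisson_sum_powers.
Qed.

Lemma cvg_fsum (I : finType) (P : pred I) (f : I -> R^nat) (l : I -> R) :
  (forall i, (f i @ \oo --> l i)%classic) ->
  ((fun N => \sum_(i | P i) f i N) @ \oo --> \sum_(i | P i) l i)%classic.
Proof. by move=> fl; apply: cvg_big => [|i _]; [exact: add_continuous|exact: fl]. Qed.

End PoissonSeries.

Section ContinuizedWalk.
Variables (R : realType) (gT : finGroupType) (n : nat) (t : R).
Hypotheses (n_gt0 : (0 < n)%N) (t_ge0 : 0 <= t).
Notation W := (wreath gT n).
Notation T := {perm 'I_n}.
Notation Q := (@paired_shuffles R gT n).

Definition perm_continuized (s : T) : R :=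
  limn (poisson_sum t (fun k => perm_walk R gT n k s)).

Lemma continuized_cvg (a : W) :
  (poisson_sum t (fun k => convolution_pow Q k a) @ \oo --> continuized Q t a)%classic.
Proof.
apply: poisson_sum_cvg => // k; rewrite shuffle_pow_ge0 //=.
rewrite -(sum_shuffle_pow R gT n_gt0 k) (bigD1 a) //= lerDl sumr_ge0 // => b _.
exact: shuffle_pow_ge0.
Qed.

Lemma perm_continuized_cvg s :
  (poisson_sum t (fun k => perm_walk R gT n k s) @ \oo --> perm_continuized s)%classic.
Proof.
apply: poisson_sum_cvg => // k; rewrite perm_walk_ge0 //=.
rewrite -(sum_perm_walk R gT n_gt0 k) (bigD1 s) //= lerDl sumr_ge0 // => b _.
exact: perm_walk_ge0.
Qed.

Lemma poisson_sum_fsum (I : finType) (u : I -> R^nat) N :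
  \sum_i poisson_sum t (u i) N = poisson_sum t (fun k => \sum_i u i k) N.
Proof.
rewrite poisson_sumE; under eq_bigr do rewrite poisson_sumE.
by rewrite exchange_big; apply: eq_bigr => k _; rewrite mulr_sumr.
Qed.

Lemma poisson_sum1 : (poisson_sum t (fun=> 1) @ \oo --> (1 : R))%classic.
Proof.
have := @poisson_sum_powers R t 1; rewrite subrr mulr0 expR0.
by under eq_fun do rewrite expr1n.
Qed.

Lemma sum_continuized : \sum_a continuized Q t a = 1.
Proof.
rewrite -(cvg_lim _ (cvg_fsum (P := xpredT) (fun a => @continuized_cvg a))) //.
apply: cvg_lim => //.
under eq_fun do rewrite poisson_sum_fsum.
apply: cvg_trans poisson_sum1; apply: near_eq_cvg; apply: nearW => N.
by rewrite !poisson_sumE; apply: eq_bigr => k _; rewrite sum_shuffle_pow.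
Qed.

Lemma continuized_ge0 (a : W) : 0 <= continuized Q t a.
Proof.
apply: (limr_ge (@continuized_cvg a)); apply: nearW => N.
rewrite poisson_sumE sumr_ge0 // => k _.
by rewrite mulr_ge0 ?poisson_weight_ge0 ?shuffle_pow_ge0.
Qed.

Lemma sum_perm_continuized : \sum_s perm_continuized s = 1.
Proof.
rewrite -(cvg_lim _ (cvg_fsum (P := xpredT) (fun s => @perm_continuized_cvg s))) //.
apply: cvg_lim => //.
under eq_fun do rewrite poisson_sum_fsum.
apply: cvg_trans poisson_sum1; apply: near_eq_cvg; apply: nearW => N.
by rewrite !poisson_sumE; apply: eq_bigr => k _; rewrite sum_perm_walk.
Qed.

(** Averages [shuffle_pow_dist] over Poisson times. The bound holds for every partial sum, hence in
    the limit. *)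
Lemma continuized_label_dist :
  \sum_(a : W) `|continuized Q t a - (#|gT|%:R ^+ n)^-1 * perm_continuized (wperm a)|
  <= 2 * (expR (- t * (1 - (n ^ 2 - n)%N%:R / n%:R ^+ 2)) +
     \sum_(A : {set 'I_n} | (0 < #|A|)%N && (2 * #|A| <= n)%N)
        expR (- t * (1 - (#|A| ^ 2 + (n - #|A|) ^ 2)%N%:R / n%:R ^+ 2))).
Proof.
have cv : ((fun N => \sum_(a : W) `|poisson_sum t (fun k => convolution_pow Q k a) N -
    (#|gT|%:R ^+ n)^-1 * poisson_sum t (fun k => perm_walk R gT n k (wperm a)) N|) @ \oo -->
  \sum_(a : W) `|continuized Q t a - (#|gT|%:R ^+ n)^-1 * perm_continuized (wperm a)|)%classic.
  apply: cvg_fsum => a; apply: cvg_norm; apply: cvgB; first exact: continuized_cvg.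
  by apply: cvgMr; exact: perm_continuized_cvg.
rewrite -(cvg_lim _ cv) //; apply: limr_le; first by apply/cvg_ex; eexists; exact: cv.
apply: nearW => N.
set x := _ / _; pose y (A : {set 'I_n}) : R := (#|A| ^ 2 + (n - #|A|) ^ 2)%N%:R / n%:R ^+ 2.
have n2 : 0 <= n%:R ^+ 2 :> R by rewrite exprn_ge0.
apply: (@le_trans _ _ (2 * (poisson_sum t (fun k => x ^+ k) N +
  \sum_(A : {set 'I_n} | (0 < #|A|)%N && (2 * #|A| <= n)%N)
      poisson_sum t (fun k => y A ^+ k) N))); last first.
  rewrite ler_pM2l // lerD ?poisson_sum_powers_le ?divr_ge0 //.
  by apply: ler_sum => A _; rewrite poisson_sum_powers_le ?divr_ge0.
rewrite [X in _ + X](_ : _ = poisson_sum t (fun k =>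
  \sum_(A : {set 'I_n} | (0 < #|A|)%N && (2 * #|A| <= n)%N) y A ^+ k) N); last first.
  rewrite poisson_sumE; under eq_bigr do rewrite poisson_sumE.
  by rewrite exchange_big; apply: eq_bigr => k _; rewrite mulr_sumr.
rewrite !poisson_sumE -big_split mulr_sumr /=.
under [X in _ <= X]eq_bigr => k _ do rewrite -mulrDr mulrCA.
apply: (@le_trans _ _ (\sum_(k < N) expR (- t) * (t ^+ k / k`!%:R) *
  \sum_(a : W) `|convolution_pow Q k a -
    (#|gT|%:R ^+ n)^-1 * perm_walk R gT n k (wperm a)|)); last first.
  apply: ler_sum => k _; rewrite ler_wpM2l ?poisson_weight_ge0 //.
  exact: shuffle_pow_dist.
under [X in _ <= X]eq_bigr do rewrite mulr_sumr.
rewrite exchange_big; apply: ler_sum => a _.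
rewrite !poisson_sumE mulr_sumr -sumrB; apply: le_trans (ler_norm_sum _ _ _) _.
apply: ler_sum => k _; rewrite [X in _ - X]mulrCA -mulrBr normrM.
by rewrite (ger0_norm (poisson_weight_ge0 _ t_ge0)).
Qed.

Lemma sum_perm_continuized_sqr P (d : 'rV[R]_(nperms n).+1) :
  P \in unitmx -> P *m swap_mx R n = diag_mx d *m P ->
  n`!%:R * \sum_s perm_continuized s ^+ 2 =
    \sum_i expR (- t * (1 - d 0 i / n%:R ^+ 2)) ^+ 2.
Proof.
move=> Pu PK.
have fact0 : n`!%:R != 0 :> R by rewrite pnatr_eq0 -lt0n fact_gt0.
have cl : ((fun N => \sum_s poisson_sum t (fun k => perm_walk R gT n k s) N ^+ 2) @ \oo -->
    \sum_s perm_continuized s ^+ 2)%classic.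
  by apply: cvg_fsum => s; rewrite expr2; apply: cvgM; exact: perm_continuized_cvg.
have cr : ((fun N => (n`!%:R)^-1 *
      \sum_i poisson_sum t (fun k => (d 0 i / n%:R ^+ 2) ^+ k) N ^+ 2) @ \oo -->
    (n`!%:R)^-1 * \sum_i expR (- t * (1 - d 0 i / n%:R ^+ 2)) ^+ 2)%classic.
  apply: cvgMr; apply: cvg_fsum => i; rewrite expr2.
  by apply: cvgM; exact: poisson_sum_powers.
apply: (canLR (mulVKf fact0)).
rewrite -(cvg_lim _ cl) //; apply: cvg_lim => //.
apply: cvg_trans cr; apply: near_eq_cvg; apply: nearW => N /=.
pose w k : R := expR (- t) * (t ^+ k / k`!%:R).
(* The truncated law is a polynomial in K applied to the point mass, so the trace formula applies
   before [N] tends to infinity. *)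
pose q : {poly R} := \sum_(k < N) w k *: ((n%:R ^+ 2)^-1 ^+ k *: 'X^k).
have qd i : q.[d 0 i] = poisson_sum t (fun k => (d 0 i / n%:R ^+ 2) ^+ k) N.
  rewrite poisson_sumE horner_sum; apply: eq_bigr => k _.
  by rewrite !hornerZ hornerXn exprMn [X in _ * X]mulrC.
have qs s : swap_horner q (perm_unit R n) s = poisson_sum t (fun k => perm_walk R gT n k s) N.
  rewrite poisson_sumE ffunE /q rmorph_sum /= mulmx_sumr summxE; apply: eq_bigr => k _.
  by rewrite linearZ /= -scalemxAr mxE perm_walk_horner // [in RHS]ffunE.
under [in LHS]eq_bigr do rewrite -qd.
by rewrite -(sum_swap_horner_sqr _ Pu PK); apply: eq_bigr => s _; rewrite -qs.
Qed.

End ContinuizedWalk.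

(** * Numerical bounds at the cutoff time *)

Section NumericalBounds.
Variable R : realType.

(** Pair the factor i + 1 of one factorial with a - i in the other: each product is at least a. *)
Lemma expnn_le_fact_sqr a : (a ^ a <= a`! ^ 2)%N.
Proof.
have -> : (a`! ^ 2 = \prod_(0 <= i < a) (i.+1 * (a - i)))%N.
  rewrite -mulnn big_split /= fact_prod big_add1 /=; congr (_ * _)%N.
  by rewrite big_nat_rev /= add0n; apply: eq_big_nat => i /andP[_ ia]; lia.
rewrite -[X in (_ ^ X)%N]subn0 -prod_nat_const_nat big_nat [leqRHS]big_nat.
apply: leq_prod => i /andP[_ ia].
have [k ->] : exists k, a = (i + k.+1)%N by exists (a - i.+1)%N; lia.
by rewrite addKn; nia.
Qed.

Lemma bin_mul_fact_le n j : ('C(n, j) * j`! <= n ^ j)%N.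
Proof.
rewrite bin_ffact; elim: j => [|j IHj]; first by rewrite ffactn0.
by rewrite ffactnSr expnSr leq_mul // leq_subr.
Qed.

Lemma expR1_le4 : expR 1 <= 4 :> R.
Proof.
have h : 2^-1 <= expR (- 2^-1) :> R by apply: le_trans (expR_ge1Dx _); lra.
have hp : 0 < expR (- 2^-1) :> R by exact: expR_gt0.
have -> : expR 1 = (expR (- 2^-1))^-1 ^+ 2 :> R.
  by rewrite -expRN opprK -expRM_natl; congr expR; field.
have h2 : (expR (- 2^-1))^-1 <= 2 :> R by rewrite -[leRHS]invrK lef_pV2 ?posrE.
have : 0 <= (expR (- 2^-1))^-1 :> R by rewrite invr_ge0 ltW.
rewrite expr2; nra.
Qed.

Lemma mul_ln_le m n : (0 < m <= n)%N -> m%:R * ln n%:R <= n%:R * (ln m%:R + 1) :> R.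
Proof.
move=> /andP[m0 mn].
have m0' : 0 < m%:R :> R by rewrite ltr0n.
have n0' : 0 < n%:R :> R by rewrite ltr0n (leq_trans m0).
have nm0 : 0 < n%:R / m%:R :> R by rewrite divr_gt0.
have := ln_sublinear nm0; rewrite ln_div ?posrE // => /ltW lnm.
have lm : 0 <= ln m%:R :> R by rewrite ln_ge0 // ler1n.
have mn' : m%:R <= n%:R :> R by rewrite ler_nat.
have := ler_wpM2l (ltW m0') lnm.
rewrite [X in _ <= X]mulrC mulfVK ?gt_eqF // mulrBr.
have := ler_wpM2r lm mn'; nra.
Qed.

(* By [mul_ln_le] the square of the left-hand side is at most                  *)
(* [(4 l a) ^ a], and [a ^ a <= a`! ^ 2].                                      *)
Lemma expR_sqr_ln_le (l a n : nat) : (0 < l <= 4)%N -> (0 < n)%N -> (l * a <= n)%N ->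
  expR (2^-1 * (a%:R * ((l * a)%N%:R * ln n%:R / n%:R))) <= a`!%:R * 4 ^+ a :> R.
Proof.
move=> /andP[l0 l4] n0; have [->|a0] := posnP a.
  by rewrite mul0r mulr0 expR0 fact0 mulr1.
move=> lan; have la0 : (0 < l * a)%N by rewrite muln_gt0 l0.
have n0' : 0 < n%:R :> R by rewrite ltr0n.
set y := _ * _; rewrite -ler_sqr ?nnegrE ?expR_ge0 ?mulr_ge0 ?exprn_ge0 ?ler0n //.
rewrite -expRM_natl.
apply: (@le_trans _ _ (expR (a%:R * (ln (l * a)%N%:R + 1)))).
  rewrite ler_expR /y mulVKf ?pnatr_eq0 // ler_wpM2l ?ler0n //.
  rewrite ler_pdivrMr // [leRHS]mulrC; apply: mul_ln_le.
  by rewrite la0.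
rewrite expRM_natl expRD lnK ?posrE ?ltr0n // -!natrX.
apply: (@le_trans _ _ (((4 * a)%N%:R * 4) ^+ a)).
  rewrite lerXn2r ?nnegrE ?mulr_ge0 ?expR_ge0 ?ler0n //.
  apply: ler_pM; rewrite ?ler0n ?expR_ge0 ?expR1_le4 // ler_nat.
  by rewrite leq_mul2r l4 orbT.
rewrite -!natrM -!natrX ler_nat (_ : 4 * a * 4 = a * 16)%N; last by lia.
rewrite !expnMn -expnM (mulnC a 2) (expnM 4 2).
by rewrite leq_mul ?expnn_le_fact_sqr.
Qed.

Lemma geometric_sum_le (x : R) n : 0 <= x <= 2^-1 -> \sum_(1 <= j < n.+1) x ^+ j <= 2 * x.
Proof.
move=> /andP[x0 x2].
suff : \sum_(1 <= j < n.+1) x ^+ j <= 2 * x * (1 - x ^+ n).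
  have : 0 <= x ^+ n by rewrite exprn_ge0.
  by have := x0; nra.
elim: n => [|n IHn]; first by rewrite big_geq // expr0 subrr mulr0.
rewrite big_nat_recr //=; apply: le_trans (lerD IHn (lexx _)) _.
have : 0 <= x ^+ n by rewrite exprn_ge0.
rewrite exprS => xn.
have : 0 <= x * (x ^+ n * (1 - 2 * x)) by rewrite !mulr_ge0 // subr_ge0; lra.
by nra.
Qed.

(** Cauchy-Schwarz, read off from the nonnegativity of the variance of the absolute values. *)
Lemma sum_norm_sqr_le (I : finType) (x : I -> R) :
  (\sum_i `|x i|) ^+ 2 <= #|I|%:R * \sum_i x i ^+ 2.
Proof.
have [/eqP I0|I0] := posnP #|I|.
  by rewrite !big1 ?mulr0 ?expr0n // => i; have := card0_eq (eqP I0) i; rewrite inE.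
have N0 : 0 < #|I|%:R :> R by rewrite ltr0n.
set S := \sum_i `|x i|; pose m := S / #|I|%:R.
have : 0 <= \sum_i (`|x i| - m) ^+ 2 by apply: sumr_ge0 => i _; rewrite sqr_ge0.
have -> : \sum_i (`|x i| - m) ^+ 2 = \sum_i x i ^+ 2 - S ^+ 2 / #|I|%:R.
  under eq_bigr do rewrite sqrrB real_normK ?num_real // -[_ * m *+ 2]mulr_natr -mulrA.
  rewrite big_split sumrB /= sumr_const -mulr_suml -/S -[m ^+ 2 *+ _]mulr_natl /m.
  field.
  by rewrite gt_eqF.
by rewrite subr_ge0 ler_pdivrMr // mulrC.
Qed.

Lemma card_sets_sum n (P : pred nat) (F : nat -> R) :
  \sum_(A : {set 'I_n} | P #|A|) F #|A| = \sum_(a < n.+1 | P a) 'C(n, a)%:R * F a.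
Proof.
have cardn (A : {set 'I_n}) : (#|A| < n.+1)%N by rewrite ltnS -[X in (_ <= X)%N]card_ord max_card.
rewrite (partition_big (fun A : {set 'I_n} => Ordinal (cardn A)) (fun a : 'I_n.+1 => P a)) //.
apply: eq_bigr => a Pa.
rewrite (eq_bigr (fun=> F a)) => [|A /andP[_ /eqP <-]] //.
rewrite sumr_const -[F a *+ _]mulr_natl; congr (_%:R * _).
rewrite -[n in 'C(n, _)]card_ord -card_draws; apply: eq_card => A.
rewrite !inE [LHS]/in_mem /= -val_eqE /=.
by case: eqP => [->|]; rewrite ?andbT ?andbF.
Qed.

End NumericalBounds.

(** * The terms of the two geometric series *)

Section Bounds.
Variables (R : realType) (n : nat) (c : R).
Hypotheses (n_gt0 : (0 < n)%N) (c_gt0 : 0 < c).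

Let t : R := 2^-1 * n%:R * ln n%:R + c * n%:R.
Let n0 : 0 < n%:R :> R. Proof. by rewrite ltr0n. Qed.
Let lnn : 0 <= ln n%:R :> R. Proof. by rewrite ln_ge0 // ler1n. Qed.

Lemma cutoff_time_ge0 : 0 <= t.
Proof. by rewrite addr_ge0 ?mulr_ge0 ?invr_ge0 ?ler0n // ltW. Qed.

Lemma expR_ln_natl j : expR (j%:R * ln n%:R) = (n ^ j)%N%:R :> R.
Proof. by rewrite expRM_natl lnK ?posrE // natrX. Qed.

Lemma cut_term_le a : (2 * a <= n)%N ->
  'C(n, a)%:R * expR (- t * (1 - (a ^ 2 + (n - a) ^ 2)%N%:R / n%:R ^+ 2))
    <= (4 * expR (- c)) ^+ a.
Proof.
move=> an; have fa : 0 < a`!%:R :> R by rewrite ltr0n fact_gt0.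
(* [z] is a^2 ln n / n, the part of the exponent by which the decay falls short of n^(-a). Its
   exponential is absorbed by a! 4^a, and C(n, a) a! by n^a. *)
pose z : R := 2^-1 * (a%:R * ((2 * a)%N%:R * ln n%:R / n%:R)).
have za : expR z <= a`!%:R * 4 ^+ a by exact: expR_sqr_ln_le.
apply: (@le_trans _ _ ('C(n, a)%:R * expR (z - a%:R * ln n%:R - a%:R * c))).
  rewrite ler_wpM2l ?ler0n // ler_expR.
  have -> : - t * (1 - (a ^ 2 + (n - a) ^ 2)%N%:R / n%:R ^+ 2) =
      z - a%:R * ln n%:R - a%:R * c * (2 * (n%:R - a%:R) / n%:R).
    rewrite /t /z natrD !natrX natrB; last by lia.
    by rewrite natrM; field; rewrite gt_eqF.
  rewrite lerD2l lerN2 ler_peMr ?mulr_ge0 ?ler0n ?(ltW c_gt0) //.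
  rewrite ler_pdivlMr // mul1r.
  have : (2 * a)%N%:R <= n%:R :> R by rewrite ler_nat.
  by rewrite natrM; lra.
rewrite !expRD expRN expR_ln_natl -(mulrN a%:R) expRM_natl exprMn !mulrA.
rewrite ler_wpM2r ?exprn_ge0 ?expR_ge0 // ler_pdivrMr ?ltr0n ?expn_gt0 ?n_gt0 //.
apply: (@le_trans _ _ ('C(n, a)%:R * (a`!%:R * 4 ^+ a))).
  by rewrite ler_wpM2l ?ler0n.
rewrite mulrA mulrC ler_wpM2l ?exprn_ge0 // -natrM ler_nat.
exact: bin_mul_fact_le.
Qed.

(** For 4 j > n the bound n (n - j) yields a decay n^(-j), leaving C(n, j) <= 2^n <= 16^j. For 4 j
    <= n the bound (n - j)^2 + j^2 yields n^(-2 j), up to exp(2 j^2 ln n / n) <= j! 4^j. *)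
Lemma shape_term_le j : (0 < j <= n)%N ->
  ('C(n, j) * n ^ j)%N%:R *
    expR (- t * (1 - (shape_bound n (n - j))%:R / n%:R ^+ 2)) ^+ 2
    <= (16 * expR (- (2 * c))) ^+ j.
Proof.
move=> /andP[j0 jn]; rewrite -expRM_natl mulrA.
have e2 : 0 <= expR (- (2 * c)) by exact: expR_ge0.
have t2 : 2 * - t <= 0 by have := cutoff_time_ge0; lra.
have [j4|j4] := leqP (4 * j) n; last first.
  apply: (@le_trans _ _ (('C(n, j) * n ^ j)%N%:R *
      expR (- (j%:R * ln n%:R) + j%:R * (- (2 * c))))).
    rewrite ler_wpM2l ?ler0n // ler_expR.
    have : 1 - (shape_bound n (n - j))%:R / n%:R ^+ 2 >= j%:R / n%:R :> R.
      have := shape_bound_le_mul n (n - j); rewrite -(ler_nat R) natrM natrB //.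
      rewrite -(ler_pM2r (_ : 0 < (n%:R ^+ 2)^-1)) ?invr_gt0 ?exprn_gt0 //.
      have -> : n%:R * (n%:R - j%:R) / n%:R ^+ 2 = 1 - j%:R / n%:R :> R.
        by field; rewrite gt_eqF.
      by lra.
    move/(ler_wnM2l t2) => /le_trans; apply.
    by rewrite /t le_eqVlt; apply/orP; left; apply/eqP; field; rewrite gt_eqF.
  rewrite expRD expRN expR_ln_natl expRM_natl exprMn mulrA.
  rewrite ler_wpM2r ?exprn_ge0 // ler_pdivrMr ?ltr0n ?expn_gt0 ?n_gt0 // -natrX -natrM ler_nat.
  rewrite leq_mul2r; apply/orP; right.
  apply: (@leq_trans (2 ^ n)); last by rewrite (_ : 16 = 2 ^ 4)%N // -expnM leq_exp2l // ltnW.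
  have := expnDn 1 1 n; rewrite addn1 => ->.
  rewrite (bigD1 (Ordinal (_ : j < n.+1)%N)) //=.
  by rewrite !exp1n !muln1 leq_addr.
have fj : 0 < j`!%:R :> R by rewrite ltr0n fact_gt0.
pose z : R := 2^-1 * (j%:R * ((4 * j)%N%:R * ln n%:R / n%:R)).
have zj : expR z <= j`!%:R * 4 ^+ j by exact: expR_sqr_ln_le.
apply: (@le_trans _ _ (('C(n, j) * n ^ j)%N%:R *
    expR (z - (j + j)%N%:R * ln n%:R + j%:R * (- (2 * c))))).
  rewrite ler_wpM2l ?ler0n // ler_expR.
  have : 1 - (shape_bound n (n - j))%:R / n%:R ^+ 2 >=
      2 * j%:R * (n%:R - j%:R) / n%:R ^+ 2 :> R.
    have := shape_bound_le_sqr j4; rewrite -(ler_nat R) natrD !natrX natrB //.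
    rewrite -(ler_pM2r (_ : 0 < (n%:R ^+ 2)^-1)) ?invr_gt0 ?exprn_gt0 //.
    have -> : ((n%:R - j%:R) ^+ 2 + j%:R ^+ 2) / n%:R ^+ 2 =
        1 - 2 * j%:R * (n%:R - j%:R) / n%:R ^+ 2 :> R.
      by field; rewrite gt_eqF.
    by lra.
  move/(ler_wnM2l t2) => /le_trans; apply.
  have -> : 2 * - t * (2 * j%:R * (n%:R - j%:R) / n%:R ^+ 2) =
      z - (j + j)%N%:R * ln n%:R + j%:R * (- (2 * c)) * (2 * (n%:R - j%:R) / n%:R).
    by rewrite /t /z natrD natrM; field; rewrite gt_eqF.
  rewrite lerD2l mulrN mulNr lerN2 ler_peMr ?mulr_ge0 ?ler0n ?(ltW c_gt0) //.
  rewrite ler_pdivlMr // mul1r.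
  have : (4 * j)%N%:R <= n%:R :> R by rewrite ler_nat.
  by rewrite natrM; have : 0 <= j%:R :> R by []; lra.
rewrite !expRD expRN expR_ln_natl expRM_natl [in leRHS]exprMn !mulrA.
rewrite ler_wpM2r ?exprn_ge0 // ler_pdivrMr ?ltr0n ?expn_gt0 ?n_gt0 //.
apply: (@le_trans _ _ (('C(n, j) * n ^ j)%N%:R * (j`!%:R * 4 ^+ j))).
  by rewrite ler_wpM2l ?ler0n.
rewrite -!natrX -!natrM ler_nat expnD.
have := bin_mul_fact_le n j; rewrite -(leq_pmul2r (_ : 0 < n ^ j * 4 ^ j)%N); last first.
  by rewrite muln_gt0 !expn_gt0 n_gt0.
have : (4 ^ j <= 16 ^ j)%N by rewrite leq_exp2r.
rewrite -(leq_pmul2r (_ : 0 < n ^ j * n ^ j)%N); last by rewrite muln_gt0 expn_gt0 n_gt0.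
move: ('C(n, j)) (n ^ j)%N (j`!) (4 ^ j)%N (16 ^ j)%N => x1 x2 x3 x4 x5.
by lia.
Qed.

End Bounds.

(** * Assembling the total variation bound *)

Section TotalVariation.
Variables (R : realType) (gT : finGroupType) (n : nat) (c : R).
Hypotheses (n_gt0 : (0 < n)%N) (c_gt0 : 0 < c).
Notation W := (wreath gT n).

Let t : R := 2^-1 * n%:R * ln n%:R + c * n%:R.
Let t_ge0 : 0 <= t. Proof. exact: cutoff_time_ge0. Qed.

Lemma sum_eigenvalues_le (P : 'M[R]_((nperms n).+1)) (d : 'rV[R]_(nperms n).+1) :
  (forall i, d 0 i <= (n ^ 2)%:R) ->
  (forall r, (0 < r <= n)%N ->
     (#|[set i | ((shape_bound n r.-1)%:R < d 0 i)%R]| <= 'C(n, n - r) * n ^ (n - r))%N) ->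
  \sum_i expR (- t * (1 - d 0 i / n%:R ^+ 2)) ^+ 2 <=
    1 + \sum_(1 <= j < n.+1) (16 * expR (- (2 * c))) ^+ j.
Proof.
move=> dn dC; pose phi (x : R) := expR (- t * (1 - x / n%:R ^+ 2)) ^+ 2.
have n2 : 0 < (n%:R ^+ 2)^-1 :> R by rewrite invr_gt0 exprn_gt0 // ltr0n.
have phi_ge0 x : 0 <= phi x by rewrite exprn_ge0 ?expR_ge0.
have phi_mono x y : x <= y -> phi x <= phi y.
  move=> xy; rewrite lerXn2r ?nnegrE ?expR_ge0 // ler_expR !mulNr lerN2.
  by rewrite ler_wpM2l // lerD2l lerN2 ler_pM2r.
have kapn : shape_bound n n = (n ^ 2)%N.
  apply/eqP; rewrite eqn_leq -[X in (_ <= X)%N && _]mulnn shape_bound_le_mul /=.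
  apply: leq_trans (leq_bigmax (ord_max : 'I_n.+1)) => /=.
  by rewrite subnn mulnn addn0 minnn.
have count (x : R) :
    \sum_i ((x < d 0 i)%R)%:R = #|[set i | (x < d 0 i)%R]|%:R :> R.
  rewrite -natr_sum -sum1_card [in RHS]big_mkcond; congr (_%:R).
  by apply: eq_bigr => i _; rewrite inE; case: ifP.
(* The least r with [d 0 i <= shape_bound n r] selects a term that dominates [phi (d 0 i)]. *)
have layer i : phi (d 0 i) <= phi (shape_bound n 0)%:R + \sum_(1 <= r < n.+1)
    (((shape_bound n r.-1)%:R < d 0 i)%R)%:R * phi (shape_bound n r)%:R.
  have ex : exists r, d 0 i <= (shape_bound n r)%:R by exists n; rewrite kapn.
  have sum0 : 0 <= \sum_(1 <= r < n.+1)
      (((shape_bound n r.-1)%:R < d 0 i)%R)%:R * phi (shape_bound n r)%:R.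
    by rewrite sumr_ge0 // => r _; rewrite mulr_ge0.
  case: (ex_minnP ex) => -[|r] dr minr; first by rewrite ler_wpDr // phi_mono.
  have rn : (r < n)%N by apply: minr; rewrite kapn.
  rewrite ler_wpDl // (bigD1_seq r.+1) ?iota_uniq ?mem_index_iota ?ltnS //=.
  have -> : ((shape_bound n r)%:R < d 0 i)%R.
    by rewrite ltNge; apply/negP => /minr; rewrite ltnn.
  rewrite mul1r ler_wpDr ?phi_mono //.
  by rewrite sumr_ge0 // => s _; rewrite mulr_ge0.
apply: le_trans (ler_sum _ (fun i _ => layer i)) _.
rewrite big_split exchange_big /= sumr_const card_ord [X in _ *+ X + _]card_perms card_Sn.
rewrite big_nat_recr //=.
have last_term : \sum_i (((shape_bound n n.-1)%:R < d 0 i)%R)%:R * phi (shape_bound n n)%:R <= 1.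
  rewrite -mulr_suml -[leRHS]mulr1 ler_pM ?sumr_ge0 //.
    rewrite count lern1.
    by apply: leq_trans (dC n _) _; rewrite ?n_gt0 ?leqnn // subnn bin0.
  rewrite /phi kapn natrX mulfV ?subrr ?mulr0 ?expR0 ?expr1n //.
  by rewrite expf_neq0 // pnatr_eq0 -lt0n.
(* The layer r = n gave the 1. A layer 0 < r < n goes with j = n - r, and the bulk term n!
   [phi (shape_bound n 0)] with j = n, since n! <= n^n. *)
rewrite addrA addrC lerD // [leRHS]big_nat_recr //= addrC.
apply: lerD.
  rewrite big_nat [leRHS]big_nat_rev big_nat /=; apply: ler_sum => r /andP[r0 rn].
  rewrite add1n subSS; have rr : (0 < n - r <= n)%N by lia.
  apply: le_trans (shape_term_le n_gt0 c_gt0 rr).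
  rewrite subKn ?(ltnW rn) // -mulr_suml ler_wpM2r // count ler_nat.
  by apply: dC; rewrite r0 ltnW.
have nn : (0 < n <= n)%N by rewrite n_gt0 leqnn.
apply: le_trans (shape_term_le n_gt0 c_gt0 nn); rewrite subnn -[leLHS]mulr_natl.
rewrite ler_wpM2r // ler_nat binn mul1n.
by have := bin_mul_fact_le n n; rewrite binn mul1n.
Qed.

(** With e = exp(-c) <= 1/8, the ratio 16 e^2 is at most 1/2, so the squared distance is at most 32
    e^2 <= (6 e)^2. *)
Lemma perm_continuized_dist : expR (- c) <= 8^-1 ->
  \sum_(s : {perm 'I_n}) `|perm_continuized gT t s - (n`!%:R)^-1| <= 6 * expR (- c).
Proof.
move=> c8; set e := expR (- c) in c8 *; have e0 : 0 <= e by exact: expR_ge0.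
have [P [d [Pu PK dn dC]]] := swap_mx_spectrum R n_gt0.
have fact0 : n`!%:R != 0 :> R by rewrite pnatr_eq0 -lt0n fact_gt0.
have e2 : expR (- (2 * c)) = e ^+ 2 by rewrite -expRM_natl mulrN.
rewrite -ler_sqr ?nnegrE ?sumr_ge0 ?mulr_ge0 //.
apply: le_trans (sum_norm_sqr_le _) _; rewrite card_Sn.
have -> : n`!%:R * \sum_(s : {perm 'I_n}) (perm_continuized gT t s - (n`!%:R)^-1) ^+ 2 =
    n`!%:R * (\sum_(s : {perm 'I_n}) perm_continuized gT t s ^+ 2) - 1.
  under eq_bigr do rewrite sqrrB -[_ *+ 2]mulr_natr -mulrA.
  rewrite big_split sumrB /= -mulr_suml sum_perm_continuized // sumr_const card_Sn.
  by rewrite -[_ ^+ 2 *+ _]mulr_natl; field.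
rewrite (sum_perm_continuized_sqr _ _ _ Pu PK) // lerBlDl.
apply: le_trans (sum_eigenvalues_le P dn dC) _; rewrite lerD2l e2.
have e8 : e ^+ 2 <= 64^-1 by rewrite expr2; nra.
apply: le_trans (geometric_sum_le n _) _.
  by rewrite mulr_ge0 ?sqr_ge0 //=; lra.
by rewrite exprMn; have := sqr_ge0 e; lra.
Qed.

(** Missing loops cost exp(-c) and cuts 8 exp(-c), the latter from a geometric series of ratio 4
    exp(-c) <= 1/2; both are doubled. *)
Lemma label_dist_le : expR (- c) <= 8^-1 ->
  \sum_(a : W) `|continuized (@paired_shuffles R gT n) t a -
     (#|gT|%:R ^+ n)^-1 * perm_continuized gT t (wperm a)| <= 18 * expR (- c).
Proof.
move=> c8; apply: le_trans (continuized_label_dist gT n_gt0 t_ge0) _.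
have n0 : 0 < n%:R :> R by rewrite ltr0n.
have loops : expR (- t * (1 - (n ^ 2 - n)%N%:R / n%:R ^+ 2)) <= expR (- c).
  rewrite ler_expR natrB; last by rewrite -mulnn leq_pmulr.
  have -> : - t * (1 - ((n ^ 2)%N%:R - n%:R) / n%:R ^+ 2) = - (2^-1 * ln n%:R) - c.
    by rewrite /t natrX; field; rewrite gt_eqF.
  by rewrite lerBlDr addNr oppr_le0 mulr_ge0 ?invr_ge0 // ln_ge0 // ler1n.
have cuts : \sum_(A : {set 'I_n} | (0 < #|A|)%N && (2 * #|A| <= n)%N)
    expR (- t * (1 - (#|A| ^ 2 + (n - #|A|) ^ 2)%N%:R / n%:R ^+ 2)) <= 8 * expR (- c).
  rewrite (@card_sets_sum R n (fun a => (0 < a)%N && (2 * a <= n)%N)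
    (fun a => expR (- t * (1 - (a ^ 2 + (n - a) ^ 2)%N%:R / n%:R ^+ 2)))).
  apply: (@le_trans _ _ (\sum_(1 <= a < n.+1) (4 * expR (- c)) ^+ a)).
    rewrite big_mkcond big_ord_recl /= add0r big_add1 big_mkord; apply: ler_sum => a _.
    case: ifPn => [an|_]; first exact: cut_term_le.
    by rewrite exprn_ge0 // mulr_ge0 ?expR_ge0.
  apply: le_trans (geometric_sum_le n _) _.
    by rewrite mulr_ge0 ?expR_ge0 //=; lra.
  by rewrite mulrA; lra.
by lra.
Qed.

Lemma tv_dist_le_sum (T : finGroupType) (P Q : T -> R) :
  tv_dist P Q <= \sum_g `|P g - Q g|.
Proof.
apply: bigmax_le => [|A _]; first exact: sumr_ge0.
rewrite -sumrB; apply: le_trans (ler_norm_sum _ _ _) _.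
by rewrite [leRHS](bigID (mem A)) /= lerDl sumr_ge0.
Qed.

Lemma tv_dist_paired_shuffles :
  tv_dist (continuized (@paired_shuffles R gT n) t) (@wreath_uniform R gT n)
    <= 24 * expR (- c).
Proof.
apply: le_trans (tv_dist_le_sum _ _) _.
have UE (a : W) : wreath_uniform R a = (#|gT|%:R ^+ n)^-1 * (n`!%:R)^-1.
  by rewrite /wreath_uniform div1r invfM.
have fact0 : n`!%:R != 0 :> R by rewrite pnatr_eq0 -lt0n fact_gt0.
(* When exp(-c) > 1/8 the claimed bound exceeds 3, while the l1 distance of two probability measures
   is at most 2. *)
have [c8|c8] := leP (expR (- c)) 8^-1; last first.
  apply: (@le_trans _ _ 2); last by lra.
  apply: (@le_trans _ _ (\sum_(a : W) (continuized (@paired_shuffles R gT n) t a +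
    (#|gT|%:R ^+ n)^-1 * (n`!%:R)^-1))).
    apply: ler_sum => a _; rewrite UE; apply: le_trans (ler_normB _ _) _.
    by rewrite !ger0_norm ?continuized_ge0 // mulr_ge0 ?invr_ge0 ?exprn_ge0.
  rewrite big_split /= sum_continuized // (sum_wreath_uniform gT (fun=> (n`!%:R)^-1)).
  by rewrite sumr_const card_Sn -[_ *+ _]mulr_natl mulfV.
apply: (@le_trans _ _ (18 * expR (- c) + 6 * expR (- c))); last by lra.
apply: le_trans (lerD (label_dist_le c8) (perm_continuized_dist c8)).
rewrite -[X in _ + X](sum_wreath_uniform gT (fun s =>
   `|perm_continuized gT t s - (n`!%:R)^-1|)).
rewrite -big_split; apply: ler_sum => a _ /=; rewrite UE.
have G0 : 0 <= (#|gT|%:R ^+ n)^-1 :> R by rewrite invr_ge0 exprn_ge0.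
rewrite -[X in _ + X * _](ger0_norm G0) -normrM.
apply: le_trans (ler_normD _ _); rewrite mulrBr.
by rewrite addrA subrK.
Qed.

End TotalVariation.

Theorem theorem3p7p6 (R : realType) :
  exists b : R, 0 < b /\
    forall (gT : finGroupType) (c : R), 0 < c ->
      let t (n : nat) : R := 2^-1 * n%:R * ln n%:R + c * n%:R in
      (limn_esup (fun n : nat =>
         (tv_dist (continuized (@paired_shuffles R gT n) (t n))
                  (@wreath_uniform R gT n))%:E)
       <= (b * expR (- c))%:E)%E.
Proof.
exists 24; split; first by rewrite ltr0n.
move=> gT c c0; cbv zeta.
pose t (n : nat) : R := 2^-1 * n%:R * ln n%:R + c * n%:R.
pose u n := (tv_dist (continuized (@paired_shuffles R gT n) (t n))
                     (@wreath_uniform R gT n))%:E.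
(* The bound is uniform in n >= 1, so the limsup is compared with the supremum over positive n; n =
   0 is left out because [paired_shuffles] is then zero. *)
apply: (@le_trans _ _ (ereal_sup [set u n | n in [set n | (0 < n)%N]]))%classic.
  by apply: ereal_inf_lbound; exists [set n | (0 < n)%N]%classic => //; exists 1%N.
apply: ge_ereal_sup => _ [n n0 <-].
by rewrite lee_fin; exact: tv_dist_paired_shuffles.
Qed.
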